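(* Let $q$ be a prime power with $\gcd(q,6)=1$ and let $\mathbf{E}$ be an ordinary elliptic curve over $\mathbb{F}_q$ given by $Y^2=X^3+aX+b$ with $a,b\in\mathbb{F}_q$, $b\neq0$. Let $\chi$ be the quadratic character of $\mathbb{F}_q$ (with $\chi(0)=0$). For a positive integer $N$ and $P,Q\in\mathbf{E}(\mathbb{F}_q)$ put $$S(P,Q;N)=\sum_{n=1}^N\chi\big(x(nP)\,x(nQ)\big),\qquad U(N)=\sum_{P,Q\in\mathbf{E}(\mathbb{F}_q)}|S(P,Q;N)|^2.$$ Then $U(N)\ll N^6q+Nq^2$ for every positive integer $N$, where the implied constant is absolute.
   Context: $\mathbf{E}(\mathbb{F}_q)$ is the group of $\mathbb{F}_q$-rational points of $\mathbf{E}$, with neutral element the point at infinity $\mathcal{O}$. Points $P\ne\mathcal{O}$ are written $P=(x(P),y(P))$, and by convention $x(\mathcal{O})=0$. $\mathbf{E}$ is ordinary if $\mathbf{E}[p]\cong\mathbb{Z}/p\mathbb{Z}$, where $p$ is the characteristic. $A\ll B$ means $|A|\le cB$ for an absolute constant $c>0$. *)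

(* Defs.v *)
From HB Require Import structures.
From mathcomp Require Import all_boot all_order all_algebra all_field.
From mathcomp Require Import ring reals.

Set Implicit Arguments.
Unset Strict Implicit.
Unset Printing Implicit Defensive.

Import Order.TTheory GRing.Theory Num.Theory.
Local Open Scope ring_scope.

(* The projective closure of Y^2 = X^3 + a X + b has a single point at
   infinity, represented by None. *)
Definition on_curve (K : fieldType) (a b : K) (P : option (K * K)) : bool :=
  if P is Some (x, y) then y ^+ 2 == x ^+ 3 + a * x + b else true.

Record ec (K : fieldType) (a b : K) := EC {
  ecval :> option (K * K);
  ecvalP : on_curve a b ecval
}.

HB.instance Definition _ (K : fieldType) (a b : K) :=
  [isSub for @ecval K a b].
HB.instance Definition _ (K : fieldType) (a b : K) :=
  [Choice of ec a b by <:].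
HB.instance Definition _ (F : finFieldType) (a b : F) :=
  [Finite of ec a b by <:].

(* 4 a^3 + 27 b^2 is the discriminant up to the factor -16; its nonvanishing
   means smoothness when 2 is invertible in K. *)
Definition nonsingular (K : fieldType) (a b : K) : bool :=
  4%:R * a ^+ 3 + 27%:R * b ^+ 2 != 0.

Definition ec_add_raw (K : fieldType) (a : K) (P Q : option (K * K)) :
    option (K * K) :=
  match P, Q with
  | None, _ => Q
  | _, None => P
  | Some (x1, y1), Some (x2, y2) =>
      if (x1 == x2) && (y1 == - y2) then None else
      let l := if x1 == x2 then (3%:R * x1 ^+ 2 + a) / (2%:R * y1)
               else (y2 - y1) / (x2 - x1) in
      let x3 := l ^+ 2 - x1 - x2 in
      Some (x3, l * (x1 - x3) - y1)
  end.

Lemma ec_add_subproof (K : fieldType) (a b : K) (P Q : ec a b) :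
  on_curve a b (ec_add_raw a P Q).
Proof.
case: P Q => [[[x1 y1]|] HP] [[[x2 y2]|] HQ] //=.
case: ifP => //; move: HP HQ => /= /eqP HP /eqP HQ.
case: (eqVneq x1 x2) => [e|ne] /=.
  subst x2 => /eqP ny.
  have ey : y1 = y2.
    have : (y1 - y2) * (y1 + y2) = 0 by rewrite -subr_sqr HP HQ subrr.
    move/eqP; rewrite mulf_eq0 subr_eq0 addr_eq0 => /orP[/eqP//|/eqP//].
  subst y2.
  have y0 : 2%:R * y1 != 0.
    by apply/eqP => h; apply: ny; apply/eqP; rewrite -addr_eq0 -h; apply/eqP; ring.
  set l := _ / _.
  have hl : 2%:R * y1 * l = 3%:R * x1 ^+ 2 + a by rewrite mulrC divfK.
  have -> : b = y1 ^+ 2 - x1 ^+ 3 - a * x1 by rewrite HP; ring.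
  have -> : a = 2%:R * y1 * l - 3%:R * x1 ^+ 2 by rewrite hl; ring.
  by apply/eqP; ring.
move=> _; set l := _ / _.
have d0 : x2 - x1 != 0 by rewrite subr_eq0 eq_sym.
have hl : y2 = y1 + l * (x2 - x1) by rewrite divfK //; ring.
have ha : a = l * (y1 + y2) - (x1 ^+ 2 + x1 * x2 + x2 ^+ 2).
  apply: (mulIf d0); apply/eqP; rewrite -subr_eq0; apply/eqP.
  have -> : a * (x2 - x1) = y2 ^+ 2 - y1 ^+ 2 - (x2 ^+ 3 - x1 ^+ 3).
    by rewrite HP HQ; ring.
  by rewrite hl; ring.
have -> : b = y1 ^+ 2 - x1 ^+ 3 - a * x1 by rewrite HP; ring.
by rewrite ha hl; apply/eqP; ring.
Qed.

Definition ec_zero (K : fieldType) (a b : K) : ec a b :=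
  @EC K a b None isT.

Definition ec_add (K : fieldType) (a b : K) (P Q : ec a b) : ec a b :=
  EC (ec_add_subproof P Q).

Definition ec_muln (K : fieldType) (a b : K) (n : nat) (P : ec a b) : ec a b :=
  iter n (ec_add P) (ec_zero a b).

Definition xcoord (K : fieldType) (a b : K) (P : ec a b) : K :=
  if ecval P is Some (x, _) then x else 0.

Definition alg_closure (F : finFieldType) : closedFieldType :=
  projT1 (countable_algebraic_closure F).

Definition to_closure (F : finFieldType) : {rmorphism F -> alg_closure F} :=
  sval (projT2 (countable_algebraic_closure F)).

(* E[p] is the p-torsion of the group of points over the algebraic closure;
   f below is a group isomorphism from Z/pZ onto E[p]. *)
Definition ordinary (F : finFieldType) (a b : F) : Prop :=
  exists2 p : nat, p \in [pchar F] &
  exists f : 'Z_p -> ec (to_closure F a) (to_closure F b),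
    [/\ injective f,
        forall i j, f (i + j) = ec_add (f i) (f j)
      & forall P, ec_muln p P = ec_zero _ _ <-> exists i, f i = P].

Definition quad_char (F : finFieldType) (x : F) : int :=
  if x == 0 then 0 else if [exists y : F, y ^+ 2 == x] then 1 else -1.

Definition S_sum (F : finFieldType) (a b : F) (P Q : ec a b) (N : nat) : int :=
  \sum_(1 <= n < N.+1) quad_char (xcoord (ec_muln n P) * xcoord (ec_muln n Q)).

Definition U_sum (F : finFieldType) (a b : F) (N : nat) : int :=
  \sum_(P : ec a b) \sum_(Q : ec a b) `|S_sum P Q N| ^+ 2.

(* Main.v *)
(* Expanding the square and exchanging sums, U(N) is the sum over m, n <= N of
   T(m,n)^2, where T(m,n) is the sum over P of chi(x(mP) x(nP)).  With
   x(nP) = A_n / B_n for A_n monic of degree n^2 in x(P), and with B_n a square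
   at rational points, T(m,n) is, up to O(N^3) exceptional points, the sum over
   x of chi(A_m A_n) plus that of chi(g A_m A_n), where g = X^3 + a X + b.
   Stepanov's method bounds a sum of chi(f(x)) by O(deg f sqrt q) unless f is a
   constant times a square.  The product g A_m A_n never is, since the roots of
   g are not roots of A_n (b <> 0).  As A_n is the p^j-th power of a polynomial
   with simple roots for some j, A_m A_n can be so only if n^2 p^i = m^2 p^j for
   some i and j, that is, if m / n is a power of p.  This leaves O(N) pairs, for
   which the trivial bound O(q^2) for T(m,n)^2 is enough.  When N^4 >> q the
   trivial bound U(N) << N^2 q^2 suffices.  The fractions A_n / B_n are produced from the
   symmetric relation between the abscissas of P, nP and (n+1)P alone, as in
   Manin's proof of the Hasse bound, so that no associativity of the group law
   is used. *)

Require Import Defs.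
From HB Require Import structures.
From mathcomp Require Import all_boot all_order all_algebra.
From mathcomp Require Import all_fingroup all_solvable all_field.
From mathcomp Require Import zify ring reals.

Set Implicit Arguments.
Unset Strict Implicit.
Unset Printing Implicit Defensive.

Import Order.TTheory GRing.Theory Num.Theory FinRing.Theory.
Local Open Scope ring_scope.

(** * The quadratic character *)

(** The additive order of 1 is p, so Lagrange's theorem applies. *)
Lemma natr_dvd_card (F : finFieldType) (p : nat) :
  p \in [pchar F] -> (p %| #|F|)%N.
Proof.
rewrite inE => /andP[pr /eqP p0].
have := order_dvdG (in_setT (1 : F)); rewrite cardsT.
suff -> : #[1%R : F]%g = p by [].
have d : (#[1%R : F]%g %| p)%N by rewrite order_dvdn zmodXgE p0.
apply/eqP; case/primeP: pr => _ /(_ _ d) /orP[]//.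
by rewrite -dvdn1 order_dvdn zmodXgE mulr1n oner_eq0.
Qed.

Lemma coprime_card_natr_neq0 (F : finFieldType) (p : nat) :
  prime p -> coprime #|F| p -> p%:R != 0 :> F.
Proof.
move=> pr cop; apply/negP => p0.
have /natr_dvd_card d : p \in [pchar F] by rewrite inE pr.
by move: cop; rewrite coprime_sym prime_coprime // d.
Qed.

Lemma card_half (F : finFieldType) :
  odd #|F| -> (#|F| = (#|F|.-1./2).*2.+1)%N /\ (0 < #|F|.-1./2)%N.
Proof.
move=> oF; have := finNzRing_gt1 F; move: oF.
by move: #|F| => q; lia.
Qed.

Lemma expf_double_half (F : finFieldType) (x : F) :
  odd #|F| -> x != 0 -> x ^+ (#|F|.-1./2).*2 = 1.
Proof.
move=> oF x0; have [cq _] := card_half oF.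
by apply: (mulfI x0); rewrite -exprS -cq mulr1; exact: expf_card.
Qed.

(** Euler's criterion. A nonsquare is an odd power of a primitive root z of order q - 1 = 2h, and
    z^h = -1. *)
Lemma quad_charE (F : finFieldType) (x : F) : odd #|F| ->
  (quad_char x)%:~R = x ^+ (#|F|.-1./2).
Proof.
move=> oF; have [cq] := card_half oF; have fermat := expf_double_half oF.
move: cq fermat; move: #|F|.-1./2 => h cq fermat h_gt0.
rewrite /quad_char; case: eqVneq => [->|x0]; first by rewrite expr0n gtn_eqF.
case: existsP => [[y /eqP yx]|nsq].
  rewrite -yx -exprM mul2n fermat //.
  by apply: contraNneq x0 => y0; rewrite -yx y0 expr0n.
have /hasP[z _ prz] : has h.*2.-primitive_root (enum (predC1 (0 : F))).
  apply: has_prim_root; rewrite ?double_gt0 ?enum_uniq //.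
    by apply/allP => y; rewrite mem_enum inE => y0; apply/unity_rootP/fermat.
  by rewrite -cardE cardC1 cq.
have [i xi] := prim_rootP prz (fermat x x0).
have oi : odd i.
  case: (boolP (odd i)) => // ei; case: nsq; exists (z ^+ i./2).
  by rewrite -exprM muln2 even_halfK // xi.
have zh : z ^+ h = -1.
  have /eqP : (z ^+ h) ^+ 2 = 1 by rewrite -exprM muln2 prim_expr_order.
  rewrite sqrf_eq1 => /orP[/eqP zh|/eqP //].
  by have := prim_order_dvd prz h; rewrite zh eqxx => /(dvdn_leq h_gt0); lia.
by rewrite xi exprAC zh -signr_odd oi.
Qed.

Lemma quad_charP (F : finFieldType) (x : F) :
  [\/ quad_char x = 0, quad_char x = 1 | quad_char x = -1].
Proof.
rewrite /quad_char; case: eqP => _; first by constructor 1.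
by case: ifP => _; [constructor 2|constructor 3].
Qed.

Lemma normr_quad_char_le1 (F : finFieldType) (x : F) : `|quad_char x| <= 1.
Proof. by case: (quad_charP x) => ->. Qed.

(** Euler's criterion moves the identity into [F], where 0, 1 and -1 stay distinct because the order
    of [F] is odd. *)
Lemma quad_charM (F : finFieldType) : odd #|F| ->
  {morph @quad_char F : x y / x * y}.
Proof.
move=> oF x y.
have two0 : 2%:R != 0 :> F.
  by apply: coprime_card_natr_neq0 => //; rewrite coprimen2.
have one_neqN1 : 1 <> -1 :> F.
  by move/eqP; rewrite -subr_eq0 opprK -mulr2n => /eqP; apply/eqP.
have: (quad_char (x * y))%:~R = (quad_char x * quad_char y)%:~R :> F.
  by rewrite rmorphM /= !quad_charE // exprMn.
case: (quad_charP (x * y)) => ->; case: (quad_charP x) => ->;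
  case: (quad_charP y) => ->; rewrite ?mulr0 ?mul0r ?mulr1 ?mul1r ?mulrNN ?mulr1
    ?rmorphN ?rmorph1 ?rmorph0 //= => /eqP; rewrite ?oppr_eq0 ?oner_eq0 //
    1?eq_sym ?oppr_eq0 ?oner_eq0 //; move=> /eqP // /esym //.
Qed.

Lemma quad_char_sqr (F : finFieldType) (x : F) : x != 0 -> quad_char (x ^+ 2) = 1.
Proof.
move=> x0; rewrite /quad_char expf_eq0 /= (negPf x0).
by case: existsP => // -[]; exists x.
Qed.

Lemma card_sqr_fiber (F : finFieldType) (c : F) : odd #|F| ->
  (#|[set y : F | y ^+ 2 == c]|%:Z = 1 + quad_char c)%R.
Proof.
move=> oF; have two0 : 2%:R != 0 :> F.
  by apply: coprime_card_natr_neq0 => //; rewrite coprimen2.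
rewrite /quad_char; case: eqVneq => [->|c0].
  rewrite (_ : [set _ | _] = [set 0]) ?cards1 //.
  by apply/setP => y; rewrite !inE expf_eq0.
case: existsP => [[z /eqP zc]|nsq]; last first.
  rewrite (_ : [set _ | _] = set0) ?cards0 //.
  by apply/setP => y; rewrite !inE; apply/negP => yc; apply: nsq; exists y.
rewrite (_ : [set _ | _] = [set z; - z]); last first.
  by apply/setP => y; rewrite !inE -zc eqf_sqr.
have z0 : z != 0 by apply: contraNneq c0 => z0; rewrite -zc z0 expr0n.
rewrite cards2 -addr_eq0 -mulr2n -mulr_natl mulf_eq0 (negPf two0) (negPf z0) //.
Qed.

(** * Stepanov's method *)

Lemma pchar_nat_card (F : finFieldType) : [pchar F].-nat #|F|.
Proof.
have [p p_pr pF] := finPcharP F.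
have /andP[pG _] := fin_ring_pchar_abelem pF.
rewrite -cardsT; apply: sub_in_pnat pG => r _ /eqP ->.
by rewrite pF.
Qed.

(** Raising to the power q is additive and fixes every coefficient. *)
Lemma frobenius_poly_card (F : finFieldType) (f : {poly F}) :
  f ^+ #|F| = f \Po 'X^#|F|.
Proof.
elim/poly_ind: f => [|f c IHf].
  by rewrite comp_poly0 expr0n gtn_eqF // (ltnW (finNzRing_gt1 F)).
rewrite exprDn_pchar; last first.
  rewrite (eq_pnat _ (pchar_poly F)); exact: pchar_nat_card.
by rewrite exprMn IHf comp_polyD comp_polyM comp_polyX comp_polyC -polyC_exp expf_card.
Qed.

Lemma dvdp_expr_card_subC (F : finFieldType) (f : {poly F}) :
  'X^#|F| %| f ^+ #|F| - f.[0]%:P.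
Proof.
rewrite frobenius_poly_card; set Z := 'X^_.
have /dvdp_comp_poly-/(_ Z) : 'X - 0%:P %| f - f.[0]%:P.
  by rewrite dvdp_XsubCl /root hornerD hornerN hornerC subrr.
by rewrite comp_polyB comp_polyX comp_polyC subr0 comp_polyB comp_polyC.
Qed.

(** The excluded case of the character sum bound. Constants and the zero polynomial are included, so
    the negation forces positive degree. *)
Definition const_sqr (F : fieldType) (f : {poly F}) : Prop :=
  exists c, exists u : {poly F}, f = c *: u ^+ 2.

(* Modulo 'X^q the q-th power of f is the constant f.[0], so the divisibility
   forces r^2 f = f.[0] s^2 modulo 'X^q, hence exactly, by the degree bound. *)
Lemma stepanov_indep1 (F : finFieldType) (f r s : {poly F}) (M : nat) :
  odd #|F| -> f.[0] != 0 -> ~ const_sqr f ->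
  (size r <= M)%N -> (size s <= M)%N -> (M.*2 + size f <= #|F|.+1)%N ->
  'X^#|F| %| r + s * f ^+ (#|F|.-1./2) -> r = 0 /\ s = 0.
Proof.
move=> oF f0 nsq sr ss sM dv; have [cq h0] := card_half oF.
have fn0 : f != 0 by apply: contraNneq f0 => ->; rewrite horner0.
have dv2 : 'X^#|F| %| r ^+ 2 * f - f.[0] *: s ^+ 2.
  have -> : r ^+ 2 * f - f.[0] *: s ^+ 2 =
     (r + s * f ^+ (#|F|.-1./2)) * ((r - s * f ^+ (#|F|.-1./2)) * f)
     + s ^+ 2 * (f ^+ #|F| - f.[0]%:P).
    have -> : f ^+ #|F| = f * (f ^+ #|F|.-1./2) ^+ 2.
      by rewrite {1}cq exprS -muln2 exprM.
    by rewrite -mul_polyC; ring.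
  by rewrite dvdp_add ?(dvdp_mulr _ dv) ?(dvdp_mull _ (dvdp_expr_card_subC f)).
have eq : r ^+ 2 * f = f.[0] *: s ^+ 2.
  apply/eqP; rewrite -subr_eq0; apply: contraTT dv2 => n0.
  apply/negP => /(dvdp_leq n0); rewrite size_polyXn.
  apply/negP; rewrite -ltnNge ltnS.
  apply: (leq_trans (size_polyD _ _)); rewrite size_polyN geq_max.
  have f_gt0 : (0 < size f)%N by rewrite size_poly_gt0.
  have szX2 (u : {poly F}) : (size u <= M)%N -> (size (u ^+ 2) + size f <= #|F|.+1)%N.
    have [->|u0] := eqVneq u 0.
      by rewrite expr0n size_poly0; move: sM; clear; lia.
    have u2 := expf_neq0 2 u0; move: u2 u0; rewrite -!size_poly_gt0 => u2 u1 uM.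
    have e : size (u ^+ 2) = ((size u).-1 * 2).+1 by rewrite -(prednK u2) size_exp.
    by rewrite e; move: u1 uM sM; clear -f_gt0; lia.
  have hr : (size (r ^+ 2 * f)%R <= (size (r ^+ 2)%R + size f).-1)%N.
    exact: size_polyMleq.
  have hs : (size (f.[0] *: s ^+ 2)%R <= size (s ^+ 2)%R)%N.
    exact: size_scale_leq.
  apply/andP; split; [apply: leq_trans hr _|apply: leq_trans hs _].
    by move: (szX2 r sr); lia.
  by move: (szX2 s ss) f_gt0; lia.
have [r0|rn0] := eqVneq r 0.
  split=> //; apply/eqP; move/eqP: eq; rewrite r0 expr0n mul0r eq_sym.
  by rewrite scaler_eq0 (negPf f0) expf_eq0.
case: nsq; have : r ^+ 2 %| s ^+ 2.
  by rewrite -(dvdpZr _ _ f0) -eq dvdp_mulr.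
rewrite dvdp_pexp2r // => /dvdpP[u su]; exists f.[0], u.
apply: (mulfI (expf_neq0 2 rn0)); rewrite eq su exprMn -!mul_polyC; ring.
Qed.

(** Modulo X^q only the term j = 0 survives; [stepanov_indep1] kills it, and a factor X^q cancels
    from the rest. *)
Lemma stepanov_indep (F : finFieldType) (f : {poly F}) (M J : nat)
    (r s : 'I_J -> {poly F}) :
  odd #|F| -> f.[0] != 0 -> ~ const_sqr f ->
  (forall j, size (r j) <= M)%N -> (forall j, size (s j) <= M)%N ->
  (M.*2 + size f <= #|F|.+1)%N ->
  \sum_j (r j + s j * f ^+ (#|F|.-1./2)) * 'X^#|F| ^+ j = 0 ->
  forall j, r j = 0 /\ s j = 0.
Proof.
move=> oF f0 nsq; elim: J r s => [|J IHJ] r s sr ss sM; first by move=> _ [].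
rewrite big_ord_recl expr0 mulr1.
under eq_bigr do rewrite lift0 exprSr mulrA.
rewrite -mulr_suml => eq0.
have [r0 s0] : r ord0 = 0 /\ s ord0 = 0.
  apply: (@stepanov_indep1 F f _ _ M) => //.
  move/eqP: eq0; rewrite addr_eq0 => /eqP ->.
  by rewrite dvdpNr dvdp_mull.
move: eq0; rewrite r0 s0 mul0r !add0r => /eqP.
rewrite mulf_eq0 [_ ^+ _ == 0]expf_eq0 polyX_eq0 andbF orbF => /eqP eq0 j.
case: (unliftP ord0 j) => [i ->|-> //].
by apply: (IHJ (fun i => r (lift ord0 i)) (fun i => s (lift ord0 i))) => [k|k||].
Qed.

(** Write f = c + e with c = f(x), so that e vanishes at x and the binomial terms e^k with k >= l
    drop out. The factor c^l turns c^(h-k) into c^h c^(l-k); once c^h is known, only powers of c up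
    to l remain. *)
Lemma half_power_expansion (F : finFieldType) (f : {poly F}) (l : nat) (x : F) :
  let h := (#|F|.-1./2) in (l <= h)%N ->
  ('X - x%:P) ^+ l %| f.[x] ^+ l *: f ^+ h
    - f.[x] ^+ h *: \sum_(k < l) ('C(h, k)%:R * f.[x] ^+ (l - k)) *: (f - f.[x]%:P) ^+ k.
Proof.
move=> h lh; set c := f.[x]; set e := f - c%:P.
have -> : f ^+ h = \sum_(i < h.+1) (c ^+ (h - i) *: e ^+ i) *+ 'C(h, i).
  rewrite -[in LHS](subrK c%:P f) -/e addrC exprDn.
  by apply: eq_bigr => i _; rewrite -polyC_exp mul_polyC.
rewrite -(big_mkord xpredT (fun i => (c ^+ (h - i) *: e ^+ i) *+ 'C(h, i))).
rewrite (big_cat_nat (n := l)) ?leqW //= scalerDr addrAC big_mkord.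
apply: dvdp_add.
  rewrite [X in _ %| X](_ : _ = 0) ?dvdp0 //; apply/eqP; rewrite subr_eq0.
  rewrite !scaler_sumr; apply/eqP; apply: eq_bigr => i _.
  rewrite -scaler_nat !scalerA; congr (_ *: _).
  have il := ltn_ord i; rewrite -!mulrA mulrCA [RHS]mulrCA -!exprD.
  by congr (_ * _ ^+ _); lia.
rewrite -mul_polyC; apply: dvdp_mull; rewrite big_nat_cond.
elim/big_rec: _ => [|i u /andP[/andP[li _] _] d]; first exact: dvdp0.
apply: dvdp_add => //; rewrite -mulr_natl; apply: dvdp_mull.
rewrite -mul_polyC; apply: dvdp_mull.
apply: dvdp_trans (dvdp_exp2l _ li) _; apply: dvdp_exp2r.
by rewrite dvdp_XsubCl /root /e hornerD hornerN hornerC subrr.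
Qed.

(** * The auxiliary polynomial and its local expansions *)

Section StepanovKernel.

Variables (F : finFieldType) (f : {poly F}) (a : F) (l : nat).
Let h := #|F|.-1./2.

(* The variable 'Y stands for the point of F at which one expands, 'X for the
   local parameter there. *)
Definition stepanov_expansion : {poly {poly F}} :=
  \sum_(k < l) ('C(h, k)%:R *: f ^+ (l - k))%:P * (poly_XaY f - f%:P) ^+ k.

(** Modulo X^l this is the expansion, at a point Y of [F] with f(Y)^h = a, of f(Y)^l times
    [stepanov_poly]: X^q is replaced by Y, f^h by its truncated expansion and f(Y)^h by a. Its
    Y-degree no longer involves h. *)
Definition stepanov_jet (J : nat) (r s : 'I_J -> {poly F}) : {poly {poly F}} :=
  \sum_(j < J) ('X^j)%:P * (poly_XaY (r j) * (f ^+ l)%:P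
                      + a%:P%:P * poly_XaY (s j) * stepanov_expansion).

Definition stepanov_poly (J : nat) (r s : 'I_J -> {poly F}) : {poly F} :=
  \sum_(j < J) (r j + s j * f ^+ h) * 'X^#|F| ^+ j.

Definition evalY (x : F) (u : {poly {poly F}}) : {poly F} :=
  map_poly (horner_eval x) u.

HB.instance Definition _ (x : F) :=
  GRing.RMorphism.copy (evalY x) (map_poly (horner_eval x)).

Lemma evalYC (x : F) (p : {poly F}) : evalY x p%:P = (p.[x])%:P.
Proof. exact: map_polyC. Qed.

Lemma evalY_Xn (x : F) (n : nat) : evalY x 'X^n = 'X^n.
Proof. exact: map_polyXn. Qed.

Lemma evalY_poly_XaY (x : F) (p : {poly F}) :
  evalY x (poly_XaY p) = p \Po ('X + x%:P).
Proof.
rewrite /evalY /poly_XaY map_comp_poly rmorphD /= map_polyX map_polyC /=.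
rewrite horner_evalE hornerX; congr (_ \Po _); apply/polyP => i.
by rewrite !coef_map /= horner_evalE hornerC.
Qed.

Lemma dvdp_comp_shift (x : F) (n : nat) (p : {poly F}) :
  'X^n %| p \Po ('X + x%:P) -> ('X - x%:P) ^+ n %| p.
Proof.
move/(dvdp_comp_poly ('X - x%:P)).
rewrite -comp_polyA comp_polyD comp_polyX comp_polyC subrK comp_polyXr.
by rewrite rmorphXn /= comp_polyX.
Qed.

Lemma stepanov_jet_vanish (J : nat) (r s : 'I_J -> {poly F}) (x : F) : odd #|F| ->
  (l <= h)%N -> a != 0 -> f.[x] ^+ h = a ->
  (forall i, (i < l)%N -> (stepanov_jet r s)`_i = 0) ->
  ('X - x%:P) ^+ l %| stepanov_poly r s.
Proof.
move=> oF lh a0 fxa jet0.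
have fx0 : f.[x] != 0.
  apply: contraNneq a0 => fx0; rewrite -fxa fx0 expr0n.
  by rewrite gtn_eqF //; have [] := card_half oF.
set E := \sum_(k < l) ('C(h, k)%:R * f.[x] ^+ (l - k)) *: (f - f.[x]%:P) ^+ k.
set Psi := \sum_(j < J) x ^+ j *: (f.[x] ^+ l *: r j + a *: (s j * E)).
(* Shifted to the origin, [Psi] is the jet specialized at Y = x, whose first l coefficients
   vanish. *)
have dPsi : ('X - x%:P) ^+ l %| Psi.
  apply: dvdp_comp_shift.
  have -> : Psi \Po ('X + x%:P) = evalY x (stepanov_jet r s).
    rewrite /Psi /stepanov_jet !rmorph_sum /=; apply: eq_bigr => j _.
    rewrite rmorphM /= evalYC hornerXn mul_polyC comp_polyZ; congr (_ *: _).
    rewrite [RHS]rmorphD /= !rmorphM /= !evalY_poly_XaY !evalYC.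
    rewrite horner_exp hornerC comp_polyD !comp_polyZ comp_polyM.
    rewrite [_ * (_ ^+ l)%:P]mulrC !mul_polyC.
    congr (_ + _); rewrite -scalerAl; congr (_ *: (_ * _)).
    rewrite /E /stepanov_expansion !rmorph_sum /=; apply: eq_bigr => k _.
    rewrite comp_polyZ rmorphM !rmorphXn !rmorphB /= !evalYC evalY_poly_XaY.
    by rewrite hornerZ horner_exp mul_polyC comp_polyC.
  rewrite -(poly_take_drop l (stepanov_jet r s)) (_ : take_poly l _ = 0).
    by rewrite add0r rmorphM /= evalY_Xn dvdp_mull.
  by apply/polyP => i; rewrite coef_take_poly coef0; case: ifP => // /jet0.
have fxl0 : f.[x] ^+ l != 0 by rewrite expf_neq0.
rewrite -(dvdpZr _ _ fxl0).
suff: ('X - x%:P) ^+ l %| f.[x] ^+ l *: stepanov_poly r s - Psi.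
  by move=> d; rewrite -(subrK Psi (_ *: _)); apply: dvdp_add.
(* As x lies in [F], X^q - x = (X - x)^q, of order q >= l at x. *)
have dXq j : ('X - x%:P) ^+ l %| 'X^#|F| ^+ j - (x ^+ j)%:P.
  have /dvdp_trans: ('X - x%:P) ^+ l %| 'X^#|F| - x%:P.
    have -> : 'X^#|F| - x%:P = ('X - x%:P) ^+ #|F|.
      by rewrite [RHS]frobenius_poly_card comp_polyB comp_polyX comp_polyC.
    by apply: dvdp_exp2l; apply: (leq_trans lh); rewrite /h; lia.
  by apply; rewrite polyC_exp subrXX dvdp_mulr.
rewrite /stepanov_poly scaler_sumr -sumrB.
elim/big_rec: _ => [|j u _ du]; first exact: dvdp0.
apply: dvdp_add => //.
have -> : f.[x] ^+ l *: ((r j + s j * f ^+ h) * 'X^#|F| ^+ j) -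
  x ^+ j *: (f.[x] ^+ l *: r j + a *: (s j * E)) =
  f.[x] ^+ l *: (r j + s j * f ^+ h) * ('X^#|F| ^+ j - (x ^+ j)%:P)
  + x ^+ j *: (s j * (f.[x] ^+ l *: f ^+ h - a *: E)).
  rewrite -!mul_polyC; ring.
apply: dvdp_add; first by apply: dvdp_mull.
rewrite -[x ^+ j *: _]mul_polyC; apply/dvdp_mull/dvdp_mull.
by rewrite -fxa; apply: half_power_expansion.
Qed.

Lemma size_mul_leS (R : nzSemiRingType) (p q : {poly R}) (m n : nat) :
  (size p <= m.+1)%N -> (size q <= n.+1)%N -> (size (p * q)%R <= (m + n).+1)%N.
Proof. by move=> pm qn; apply: leq_trans (size_polyMleq _ _) _; lia. Qed.

Lemma size_exp_leS (R : nzSemiRingType) (p : {poly R}) (m n : nat) :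
  (size p <= m.+1)%N -> (size (p ^+ n) <= (m * n).+1)%N.
Proof.
by move=> pm; apply: leq_trans (size_poly_exp_leq _ _) _; rewrite ltnS leq_mul2r; lia.
Qed.

Lemma size_sum_le (R : nzSemiRingType) (I : finType) (P : I -> {poly R}) (n : nat) :
  (forall i, size (P i) <= n)%N -> (size (\sum_i P i)%R <= n)%N.
Proof. by move=> Pn; apply: leq_trans (size_sum _ _ _) _; apply/bigmax_leqP. Qed.

(** [swapXY] turns Y-degree into ordinary size. The three summands come from Y^j, from the shifted
    r_j or s_j, and from f^l or the expansion, which is homogeneous of weight l in f. *)
Lemma sizeY_stepanov_jet (J M : nat) (r s : 'I_J -> {poly F}) :
  (forall j, size (r j) <= M)%N -> (forall j, size (s j) <= M)%N ->
  (sizeY (stepanov_jet r s) <= J + M + (size f).-1 * l)%N.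
Proof.
move=> rM sM; set d := (size f).-1.
have fd : (size f <= d.+1)%N by rewrite /d; lia.
rewrite sizeYE rmorph_sum; apply: size_sum_le => j.
have J0 := ltn_ord j; rewrite rmorphM /= swapXY_polyC map_polyXn.
have [M0|M0] := posnP M.
  have r0 : r j = 0 by apply/eqP; rewrite -size_poly_eq0 -leqn0 -M0.
  have s0 : s j = 0 by apply/eqP; rewrite -size_poly_eq0 -leqn0 -M0.
  by rewrite r0 s0 poly_XaY0 mulr0 !mul0r addr0 rmorph0 mulr0 size_poly0.
apply: leq_trans (_ : (J.-1 + (M.-1 + d * l)).+1 <= _)%N; last by lia.
apply: size_mul_leS; first by rewrite size_polyXn; lia.
have XaYM (p : {poly F}) : (size p <= M -> size (swapXY (poly_XaY p)) <= (M.-1).+1)%N.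
  by rewrite swapXY_poly_XaY size_poly_XaY prednK.
rewrite rmorphD /=; apply: leq_trans (size_polyD _ _) _; rewrite geq_max.
apply/andP; split; rewrite rmorphM /=; apply: size_mul_leS; rewrite ?XaYM //.
- rewrite swapXY_polyC size_map_polyC; exact: size_exp_leS.
- rewrite rmorphM /= swapXY_polyC map_polyC /=.
  apply: leq_trans (_ : (0 + M.-1).+1 <= _)%N => //.
  by apply: size_mul_leS; rewrite ?XaYM // size_polyC_leq1.
rewrite rmorph_sum; apply: size_sum_le => k.
have kl := ltn_ord k.
have -> : (d * l = d * (l - k) + d * k)%N by rewrite -mulnDr subnK // ltnW.
rewrite rmorphM /=; apply: size_mul_leS.
  rewrite swapXY_polyC size_map_polyC; apply: leq_trans (size_scale_leq _ _) _.
  exact: size_exp_leS.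
rewrite rmorphXn /=; apply: size_exp_leS; rewrite rmorphB /= swapXY_poly_XaY swapXY_polyC.
apply: leq_trans (size_polyD _ _) _.
by rewrite size_polyN size_poly_XaY size_map_polyC maxnn.
Qed.

Lemma stepanov_jetB (J : nat) (r s r' s' : 'I_J -> {poly F}) :
  stepanov_jet (fun j => r j - r' j) (fun j => s j - s' j) =
  stepanov_jet r s - stepanov_jet r' s'.
Proof.
rewrite /stepanov_jet -sumrB; apply: eq_bigr => j _.
have XaYB p p' : poly_XaY (p - p') = poly_XaY p - poly_XaY p' :> {poly {poly F}}.
  by rewrite /poly_XaY !rmorphB.
by rewrite !XaYB; ring.
Qed.

(** Pigeonhole: there are q^(2JM) choices of coefficients and only q^(lD) possible jets, so two
    choices share a jet; the jet is additive, so their difference solves the system. *)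
Lemma exists_stepanov_jet0 (J M D : nat) :
  (J + M + (size f).-1 * l <= D)%N -> (l * D < (J * M).*2)%N ->
  exists r : 'I_J -> {poly F}, exists s : 'I_J -> {poly F},
    [/\ forall j, (size (r j) <= M)%N, forall j, (size (s j) <= M)%N,
        exists j, r j != 0 \/ s j != 0
      & forall i, (i < l)%N -> (stepanov_jet r s)`_i = 0].
Proof.
move=> szD cnt.
pose rows (A : 'M[F]_(J, M)) j := rVpoly (row j A).
have rowsM A j : (size (rows A j) <= M)%N by apply: size_poly.
pose jets (AB : 'M[F]_(J, M) * 'M[F]_(J, M)) :=
  \matrix_(i < l, e < D) (stepanov_jet (rows AB.1) (rows AB.2))`_i`_e.
have /injectivePn[[A B] [[A' B'] neq eqj]] : ~~ injectiveb jets.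
  apply/negP => /injectiveP /leq_card; apply/negP; rewrite -ltnNge.
  rewrite card_prod !card_mx -expnD addnn ltn_exp2l //; exact: finNzRing_gt1.
exists (fun j => rows A j - rows A' j), (fun j => rows B j - rows B' j).
have sub_rows (C C' : 'M[F]_(J, M)) j : rows C j - rows C' j = rows (C - C') j.
  by rewrite /rows !linearB.
have rows_inj (C C' : 'M[F]_(J, M)) : (forall j, rows C j = rows C' j) -> C = C'.
  move=> e; apply/row_matrixP => j.
  by have := congr1 (@poly_rV F M) (e j); rewrite /rows !rVpolyK.
split=> [j|j||i il]; first by rewrite sub_rows; apply: rowsM.
    by rewrite sub_rows; apply: rowsM.
  move: neq; rewrite eqE /= negb_and => /orP[] neq.
    have /existsP[j jn] : [exists j, rows A j != rows A' j].
      apply: contraR neq; rewrite negb_exists => /forallP e.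
      by apply/eqP/rows_inj => j; apply/eqP; move: (e j); rewrite negbK.
    by exists j; left; rewrite subr_eq0.
  have /existsP[j jn] : [exists j, rows B j != rows B' j].
    apply: contraR neq; rewrite negb_exists => /forallP e.
    by apply/eqP/rows_inj => j; apply/eqP; move: (e j); rewrite negbK.
  by exists j; right; rewrite subr_eq0.
rewrite stepanov_jetB; apply/polyP => e; rewrite coef0 !coefB.
have [eD|De] := ltnP e D.
  have := congr1 (fun X : 'M[F]_(l, D) => X (Ordinal il) (Ordinal eD)) eqj.
  rewrite [LHS]mxE [RHS]mxE [fst _]/= [snd _]/= => eqe.
  by apply/eqP; rewrite subr_eq0; apply/eqP.
have big (C C' : 'M[F]_(J, M)) : (stepanov_jet (rows C) (rows C'))`_i`_e = 0.
  apply: nth_default; apply: leq_trans (max_size_coefXY _ _) _.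
  by apply: leq_trans De; apply: leq_trans szD; apply: sizeY_stepanov_jet.
by apply/eqP; rewrite subr_eq0; apply/eqP/(etrans (big A B))/esym/big.
Qed.

Lemma size_stepanov_poly (J M : nat) (r s : 'I_J -> {poly F}) :
  (forall j, size (r j) <= M)%N -> (forall j, size (s j) <= M)%N ->
  (size (stepanov_poly r s) <= M + (size f).-1 * h + #|F| * J.-1)%N.
Proof.
move=> rM sM; set d := (size f).-1.
have fd : (size f <= d.+1)%N by rewrite /d; lia.
apply: size_sum_le => j; have jJ := ltn_ord j.
have [M0|M0] := posnP M.
  have r0 : r j = 0 by apply/eqP; rewrite -size_poly_eq0 -leqn0 -M0.
  have s0 : s j = 0 by apply/eqP; rewrite -size_poly_eq0 -leqn0 -M0.
  by rewrite r0 s0 mul0r addr0 mul0r size_poly0.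
have -> : (M + d * h + #|F| * J.-1 = (M.-1 + d * h + #|F| * J.-1).+1)%N by lia.
apply: size_mul_leS; last first.
  by rewrite -exprM size_polyXn ltnS leq_mul2l; lia.
apply: leq_trans (size_polyD _ _) _; rewrite geq_max; apply/andP; split.
  by apply: leq_trans (rM j) _; lia.
by apply: size_mul_leS; [apply: leq_trans (sM j) _; lia|exact: size_exp_leS].
Qed.

End StepanovKernel.

Lemma count_multiple_roots (F : finFieldType) (S : {set F}) (R : {poly F}) (l : nat) :
  R != 0 -> {in S, forall x, ('X - x%:P) ^+ l %| R} -> (l * #|S| < size R)%N.
Proof.
move=> R0 dR.
have cop (s : seq F) x : x \notin s ->
    coprimep (('X - x%:P) ^+ l) (\prod_(y <- s) ('X - y%:P) ^+ l).
  elim: s => [|y s IHs]; first by rewrite big_nil coprimep1.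
  rewrite inE negb_or big_cons => /andP[xy xs]; rewrite coprimepMr IHs // andbT.
  apply/coprimep_expl/coprimep_expr; rewrite coprimep_XsubC root_XsubC.
  by rewrite eq_sym // eq_sym.
have /dvdp_leq : \prod_(y <- enum S) ('X - y%:P) ^+ l %| R.
  have : {subset enum S <= S} by move=> x; rewrite mem_enum.
  elim: (enum S) (enum_uniq S) => [|y s IHs] /=; first by rewrite big_nil dvd1p.
  move=> /andP[ys us] sub; rewrite big_cons Gauss_dvdp ?cop //.
  rewrite dR ?IHs //= ?sub ?mem_head // => x xs; apply: sub; rewrite inE xs orbT //.
move/(_ R0); rewrite prodrXl.
have -> : size ((\prod_(i <- enum S) ('X - i%:P)) ^+ l) = (l * #|S|).+1.
  have mon := monic_prod_XsubC (enum S) xpredT (fun x => x).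
  have e := size_exp (\prod_(i <- enum S) ('X - i%:P)) l.
  have := monic_neq0 (monic_exp l mon); rewrite -size_poly_gt0 => /prednK <-.
  by rewrite e size_prod_XsubC -cardE mulnC.
by [].
Qed.

(** Independence makes the auxiliary polynomial nonzero, while it vanishes to order l at each
    counted point. *)
Lemma stepanov_count (F : finFieldType) (f : {poly F}) (a : F) (l J M : nat) :
  let h := (#|F|.-1./2)%N in let d := (size f).-1 in
  odd #|F| -> f.[0] != 0 -> ~ const_sqr f -> a != 0 -> (l <= h)%N ->
  (M.*2 + size f <= #|F|.+1)%N -> (l * (J + M + d * l) < (J * M).*2)%N ->
  (l * #|[set x | f.[x] ^+ h == a]| < M + d * h + #|F| * J.-1)%N.
Proof.
move=> h d oF f0 nsq a0 lh szM cnt.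
have [r [s [rM sM [j rs0] jet0]]] := exists_stepanov_jet0 a (leqnn _) cnt.
have R0 : stepanov_poly f r s != 0.
  apply: contraPneq rs0 => /(stepanov_indep oF f0 nsq rM sM szM)/(_ j)[-> ->].
  by rewrite eqxx; case.
apply: leq_trans (size_stepanov_poly f rM sM).
apply: count_multiple_roots => // x; rewrite inE => /eqP fxa.
exact: stepanov_jet_vanish oF lh a0 fxa jet0.
Qed.

Lemma stepanov_count_le (F : finFieldType) (f : {poly F}) (a : F) (l : nat) :
  let d := (size f).-1 in
  odd #|F| -> f.[0] != 0 -> ~ const_sqr f -> a != 0 ->
  (l ^ 2 <= #|F|)%N -> (#|F| < l.+1 ^ 2)%N -> (0 < d)%N -> (8 * d <= l)%N ->
  (2 * #|[set x | (f.[x] ^+ (#|F|.-1./2))%R == a]| <= #|F| + 2 * l * (5 * d + 4))%N.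
Proof.
move=> d oF f0 nsq a0 lq ql d0 dl.
set N := #|[set x | _]|; have [cq _] := card_half oF.
(* [M] is as large as independence allows. With 2J = l + k and 2M = l + T, solvability of the linear
   system amounts to (2d + 1) l^2 < kT, which follows from k >= 4d + 3 and 2T >= q >= l^2. *)
pose M := (#|F| - d)./2; pose J := ((l + (4 * d + 3))./2).+1.
have szf : size f = d.+1.
  rewrite /d prednK // size_poly_gt0.
  by apply: contraNneq f0 => ->; rewrite horner0.
have := @stepanov_count F f a l J M oF f0 nsq a0.
rewrite -/d -/N szf.
move: cq; rewrite -/N; move: (#|F|.-1./2) => h.
rewrite /M /J; clearbody d N; clear -lq ql d0 dl.
move: #|F| lq ql => q; rewrite -!mulnn => lq ql cq H.
have l8 : (8 <= l)%N by lia.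
have l8q : (8 * l <= q)%N by nia.
have : (2 * l * N < q * l + q * (5 * d + 4))%N.
  have : (l * N < (q - d)./2 + d * h + q * ((l + (4 * d + 3))./2))%N.
    apply: H; [lia|lia|].
    set M := (q - d)./2; set K := (l + (4 * d + 3))./2.
    have M1 : (M.*2.+1 >= q - d)%N by rewrite /M; lia.
    have K1 : (l + (4 * d + 3) <= K.+1.*2)%N by rewrite /K; lia.
    clearbody M K; clear cq ql.
    have [k Kk] : exists k, (2 * K.+1 = l + k)%N by exists (2 * K.+1 - l)%N; lia.
    have [T MT] : exists T, (2 * M = l + T)%N by exists (2 * M - l)%N; lia.
    have kd : (4 * d + 3 <= k)%N by lia.
    have Tq : (q <= 2 * T)%N by lia.
    have kT : ((4 * d + 3) * (l * l) <= k * (2 * T))%N.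
      by apply: leq_mul => //; apply: leq_trans Tq.
    have e : (2 * (K.+1 * M).*2 = (l + k) * (l + T))%N by rewrite -Kk -MT -mul2n; lia.
    have e2 : (2 * (l * (K.+1 + M + d * l)) = l * (l + k) + l * (l + T) + 2 * d * (l * l))%N.
      by rewrite -Kk -MT; lia.
    have l2 : (0 < l * l)%N by rewrite muln_gt0; lia.
    rewrite -(ltn_pmul2l (m := 2)) // e e2.
    by move: kT l2; clear; lia.
  have : ((q - d)./2.*2 <= q)%N by lia.
  have : ((l + (4 * d + 3))./2.*2 <= l + (4 * d + 3))%N by lia.
  move: ((q - d)./2) ((l + (4 * d + 3))./2) => M K; nia.
nia.
Qed.

Lemma card_roots_lt (F : finFieldType) (f : {poly F}) :
  f != 0 -> (#|[set x | root f x]| < size f)%N.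
Proof.
move=> f0; rewrite cardE; apply: max_poly_roots => //; last exact: enum_uniq.
by apply/allP => x; rewrite mem_enum inE.
Qed.

(** Stepanov's method bounds from above the number of points where the character is 1, and likewise
    -1, by q/2 + O(d l). Together these points miss at most d elements, so the two counts are
    close. *)
Theorem quad_char_sum_bound (F : finFieldType) (f : {poly F}) (l : nat) :
  let d := (size f).-1 in
  odd #|F| -> ~ const_sqr f ->
  (l ^ 2 <= #|F|)%N -> (#|F| < l.+1 ^ 2)%N -> (8 * d <= l)%N ->
  `|\sum_x quad_char f.[x]| <= (20 * d * l)%:Z.
Proof.
move=> d oF nsq lq ql dl.
have f0 : f != 0.
  by apply/eqP => f0; apply: nsq; exists 0, 0; rewrite f0 scale0r.
have d0 : (0 < d)%N.
  rewrite lt0n; apply/eqP => d0; apply: nsq; exists f`_0, 1.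
  rewrite expr1n -mul_polyC mulr1; apply: size1_polyC.
  by move: d0; rewrite /d; case: (size f) => [|[]].
have card_roots : (#|[set x | root f x]| <= d)%N.
  by rewrite -ltnS prednK ?size_poly_gt0 // card_roots_lt.
have [b fb] : exists b, ~~ root f b.
  apply/existsP; rewrite -negb_forall; apply/negP => /forallP all0.
  have : (#|F| <= d)%N.
    rewrite -cardsT; apply: leq_trans card_roots.
    by apply/subset_leq_card/subsetP => x _; rewrite inE.
  nia.
(* Translation makes the value at 0 nonzero, as Stepanov's argument requires; b exists because d <
   q. *)
pose g := f \Po ('X + b%:P).
have gx x : g.[x] = f.[x + b] by rewrite horner_comp !hornerE.
have szg : size g = size f by rewrite size_comp_poly2 // size_XaddC.
have nsqg : ~ const_sqr g.
  case=> c [u gu]; apply: nsq; exists c, (u \Po ('X - b%:P)).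
  have -> : f = g \Po ('X - b%:P).
    by rewrite /g -comp_polyA comp_polyD comp_polyX comp_polyC subrK comp_polyXr.
  by rewrite gu comp_polyZ rmorphXn.
have -> : \sum_x quad_char f.[x] = \sum_x quad_char g.[x].
  by rewrite (reindex_inj (addIr b)); apply: eq_bigr => x _; rewrite gx.
have g0 : g.[0] != 0 by rewrite gx add0r.
set h := (#|F|.-1./2)%N.
have two0 : 2%:R != 0 :> F.
  by apply: coprime_card_natr_neq0 => //; rewrite coprimen2.
have one_neqN1 : (1 == -1 :> F) = false.
  by apply/negbTE; rewrite -subr_eq0 opprK.
pose N (a : F) := #|[set x | g.[x] ^+ h == a]|.
have sumN : \sum_x quad_char g.[x] = (N 1)%:Z - (N (-1))%:Z.
  rewrite -[Posz (N 1)]natz -[Posz (N (-1))]natz /N -!sum1dep_card !natr_sum /=.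
  rewrite [X in _ = X - _]big_mkcond [X in _ = _ - X]big_mkcond -sumrB /=; apply: eq_bigr => x _.
  rewrite -quad_charE //; case: (quad_charP g.[x]) => -> /=.
  - by rewrite rmorph0 eq_sym oner_eq0 eq_sym oppr_eq0 oner_eq0 subrr.
  - by rewrite rmorph1 eqxx one_neqN1 subr0.
  - by rewrite rmorphN rmorph1 eqxx eq_sym one_neqN1 sub0r.
have NN : (#|F| <= N 1%R + N (-1)%R + d)%N.
  pose A a := [set x | g.[x] ^+ h == a].
  have : (#|F| <= N 1%R + N (-1)%R + #|[set x | root g x]|)%N.
    have sub : [set: F] \subset A 1 :|: A (-1) :|: [set x | root g x].
      apply/subsetP => x _; rewrite !inE /root -!quad_charE //.
      case: (quad_charP g.[x]) => /= e; rewrite e ?rmorphN ?rmorph1 ?eqxx ?orbT //.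
      move: e; rewrite /quad_char; case: eqP => [_ _|_]; last by case: existsP.
      by rewrite ?eqxx ?orbT.
    rewrite -cardsT; apply: leq_trans (subset_leq_card sub) _.
    apply: leq_trans (leq_of_leqif (leq_card_setU _ _)) _; rewrite leq_add2r.
    exact: leq_of_leqif (leq_card_setU _ _).
  suff -> : #|[set x | root g x]| = #|[set x | root f x]| by lia.
  rewrite -(card_imset _ (addIr b)); congr #|pred_of_set _|; apply/setP => x.
  apply/imsetP/idP => [[y]|]; first by rewrite !inE /root gx => gy ->.
  by rewrite inE => fx; exists (x - b); rewrite ?subrK // inE /root gx subrK.
have bd a : a != 0 -> (2 * N a <= #|F| + 2 * l * (5 * d + 4))%N.
  move=> a0; rewrite /d -szg; apply: stepanov_count_le => //; rewrite szg //.
have := bd 1 (oner_neq0 _); have := bd (-1).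
rewrite oppr_eq0 oner_eq0 => /(_ isT) b2 b1; rewrite sumN.
move: (N 1%R) (N (-1)%R) NN b1 b2 => N1 N2 NN b1 b2.
(* The left side is the excess 2l(5d + 4) of one upper bound plus the d possible zeros. *)
have : (10 * l * d + 8 * l + d <= 20 * d * l)%N by nia.
move: NN b1 b2; move: #|F|; clear; nia.
Qed.

(** * Abscissas of the multiples of a point *)

(* For points P1, P2 with abscissas x and A / B, the abscissas of P1 + P2 and
   P1 - P2 are the roots of xQ2 Z^2 - xQ1 Z + xQ0. *)
Section Quadratic.

Variables (R : comNzRingType) (a b x A B : R).

Definition xQ0 : R := (A * x - a * B) ^+ 2 - 4%:R * b * B * (A + x * B).
Definition xQ1 : R := 2%:R * ((A * x + a * B) * (A + x * B) + 2%:R * b * B ^+ 2).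
Definition xQ2 : R := (A - x * B) ^+ 2.

End Quadratic.

Definition weierstrass (R : comNzRingType) (a b x : R) : R := x ^+ 3 + a * x + b.

(** The relation is symmetric in the two fractions: C/D is the abscissa of P1 + P2 or P1 - P2
    exactly when P2 is, up to sign, a sum or difference of P1 and the point above C/D. *)
Lemma xQ_sym (R : comNzRingType) (a b x A B C D : R) :
  xQ2 x A B * C ^+ 2 - xQ1 a b x A B * C * D + xQ0 a b x A B * D ^+ 2 =
  xQ2 x C D * A ^+ 2 - xQ1 a b x C D * A * B + xQ0 a b x C D * B ^+ 2.
Proof. by rewrite /xQ0 /xQ1 /xQ2; ring. Qed.

(** The last factor is B^4 times the cubic at A/B. When the two roots are rational fractions, the
    right side is therefore a square. *)
Lemma xQ_disc (R : comNzRingType) (a b x A B : R) :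
  xQ1 a b x A B ^+ 2 - 4%:R * xQ0 a b x A B * xQ2 x A B =
  16%:R * (weierstrass a b x * (B * (A ^+ 3 + a * A * B ^+ 2 + b * B ^+ 3))).
Proof. by rewrite /xQ0 /xQ1 /xQ2 /weierstrass; ring. Qed.

Lemma rmorph_xQ (R S : comNzRingType) (phi : {rmorphism R -> S}) (a b x A B : R) :
  [/\ phi (xQ0 a b x A B) = xQ0 (phi a) (phi b) (phi x) (phi A) (phi B),
      phi (xQ1 a b x A B) = xQ1 (phi a) (phi b) (phi x) (phi A) (phi B)
    & phi (xQ2 x A B) = xQ2 (phi x) (phi A) (phi B)].
Proof.
by split; rewrite /xQ0 /xQ1 /xQ2
  !(rmorphB, rmorph_nat, rmorphXn, rmorphM, rmorphD).
Qed.

Lemma nonsingular_map (K L : fieldType) (phi : {rmorphism K -> L}) (a b : K) :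
  nonsingular (phi a) (phi b) = nonsingular a b.
Proof.
rewrite /nonsingular -(fmorph_eq0 phi).
by rewrite !(rmorph_nat, rmorphXn, rmorphM, rmorphD).
Qed.

Lemma nonsingular_deriv_neq0 (K : fieldType) (a b z : K) :
  nonsingular a b -> weierstrass a b z = 0 -> 3%:R * z ^+ 2 + a != 0.
Proof.
move=> ns gz; apply: contraNneq ns => gz'.
have ea : a = - (3%:R * z ^+ 2) by apply/eqP; rewrite -addr_eq0 addrC gz'.
have eb : b = 2%:R * z ^+ 3.
  by apply/eqP; rewrite -subr_eq0 -gz /weierstrass ea; apply/eqP; ring.
by rewrite ea eb; apply/eqP; ring.
Qed.

(** If B is not 0, then [xQ2] = 0 gives A = xB; [xQ1] becomes 4 B^2 times the cubic at x, and then
    [xQ0] becomes B^2 times the square of its derivative, which smoothness makes nonzero. *)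
Lemma xQ_no_common_zero (K : fieldType) (a b x A B : K) :
  2%:R != 0 :> K -> nonsingular a b ->
  xQ0 a b x A B = 0 -> xQ1 a b x A B = 0 -> xQ2 x A B = 0 -> A = 0 /\ B = 0.
Proof.
move=> two0 ns q0 q1 /eqP; rewrite expf_eq0 subr_eq0 /= => /eqP Ax.
suff B0 : B = 0 by rewrite Ax B0 mulr0.
apply/eqP; apply: contraT => Bn0.
have wx : weierstrass a b x = 0.
  apply/eqP; move/eqP: q1.
  rewrite (_ : xQ1 _ _ _ _ _ = 2%:R * (2%:R * (B ^+ 2 * weierstrass a b x))).
    by rewrite !(mulf_eq0, expf_eq0) (negPf two0) (negPf Bn0).
  by rewrite /xQ1 /weierstrass Ax; ring.
have /negP[] := nonsingular_deriv_neq0 ns wx.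
move/eqP: q0; rewrite (_ : xQ0 _ _ _ _ _ =
   B ^+ 2 * ((3%:R * x ^+ 2 + a) ^+ 2 - 8%:R * x * weierstrass a b x)).
  by rewrite wx mulr0 subr0 !(mulf_eq0, expf_eq0) (negPf Bn0) /= orbb.
by rewrite /xQ0 /weierstrass Ax; ring.
Qed.

(** * The fractions for the multiples of a generic point *)

Section XSequence.

Variables (F : finFieldType) (a b : F).
Local Notation Q0 P := (xQ0 a%:P b%:P 'X P.1 P.2).
Local Notation Q1 P := (xQ1 a%:P b%:P 'X P.1 P.2).
Local Notation Q2 P := (xQ2 'X P.1 P.2).

(** P is one root of the quadratic of Q, and Vieta's relations yield the other. The quotients are
    taken by the numerator of P, since the sequence starts at 1/0, the point at infinity, whose
    denominator vanishes. *)
Definition xnext (PQ : ({poly F} * {poly F}) * ({poly F} * {poly F})) :=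
  let: (P, Q) := PQ in
  let A := Q0 Q %/ P.1 in (Q, (A, (Q1 Q - A * P.2) %/ P.1)).

Definition xpair (n : nat) := iter n xnext ((1, 0), ('X, 1)).

(* The abscissa of n P is xnum n / xden n evaluated at the abscissa of P. *)
Definition xnum (n : nat) : {poly F} := (xpair n).1.1.
Definition xden (n : nat) : {poly F} := (xpair n).1.2.

Definition reduced_fraction (n : nat) (P : {poly F} * {poly F}) : Prop :=
  [/\ coprimep P.1 P.2, P.1 \is monic, size P.1 = (n ^ 2).+1
    & (size P.2 <= n ^ 2)%N].

(** Vieta's relations for the roots P and R of the quadratic of Q. *)
Definition xrel (P Q R : {poly F} * {poly F}) : Prop :=
  [/\ R.1 * P.1 = Q0 Q, R.1 * P.2 + P.1 * R.2 = Q1 Q & P.2 * R.2 = Q2 Q].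

(** The quadratic relation and the coprimality of A and B force A to divide [xQ0], then the
    remaining numerator, so both quotients of [xnext] are exact. *)
Lemma xrelP (P Q : {poly F} * {poly F}) : P.1 != 0 -> coprimep P.1 P.2 ->
  Q2 Q * P.1 ^+ 2 - Q1 Q * P.1 * P.2 + Q0 Q * P.2 ^+ 2 = 0 ->
  xrel P Q (xnext (P, Q)).2.
Proof.
case: P => A B /= A0 cAB phi.
have /dvdpP[A2 eA2] : A %| Q0 Q.
  rewrite -(Gauss_dvdpl _ (coprimep_expr 2 cAB)).
  have -> : Q0 Q * B ^+ 2 = A * (Q1 Q * B - Q2 Q * A).
    by apply/eqP; rewrite -subr_eq0 -phi; apply/eqP; ring.
  exact: dvdp_mulIl.
have eq1 : B * (Q1 Q - A2 * B) = A * Q2 Q.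
  apply: (mulfI A0); apply/eqP; rewrite -subr_eq0 -oppr_eq0 -phi eA2.
  by apply/eqP; ring.
have /dvdpP[B2 eB2] : A %| Q1 Q - A2 * B.
  by rewrite -(Gauss_dvdpr _ cAB) eq1 dvdp_mulIl.
rewrite /xrel /= eA2 mulpK // eB2 mulpK //; split=> //.
  by rewrite [A * _]mulrC -eB2; ring.
by apply: (mulfI A0); rewrite -eq1 eB2; ring.
Qed.

Lemma size_leD (p q : {poly F}) (n : nat) :
  (size p <= n)%N -> (size q <= n)%N -> (size (p + q)%R <= n)%N.
Proof. by move=> pn qn; apply: leq_trans (size_polyD _ _) _; rewrite geq_max pn. Qed.

Lemma size_leM (p q : {poly F}) (m n k : nat) : (m + n <= k.+1)%N ->
  (size p <= m)%N -> (size q <= n)%N -> (size (p * q)%R <= k)%N.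
Proof. by move=> mnk pm qn; apply: leq_trans (size_polyMleq _ _) _; lia. Qed.

Lemma size_natr_leq1 (n : nat) : (size (n%:R : {poly F}) <= 1)%N.
Proof. by rewrite -polyC_natr size_polyC_leq1. Qed.

Lemma reduced_xQ0 (n : nat) (Q : {poly F} * {poly F}) :
  reduced_fraction n Q -> Q0 Q \is monic /\ size (Q0 Q) = ((n ^ 2).*2.+3)%N.
Proof.
case: Q => A B [_ /= mA szA szB]; rewrite /xQ0.
have szAX : size (A * 'X) = (n ^ 2).+2 by rewrite size_mulX ?monic_neq0 // szA.
have lt1 : (size (- (a%:P * B))%R < size (A * 'X)%R)%N.
  rewrite szAX size_polyN ltnS.
  by apply: (@size_leM _ _ 1 (n ^ 2)); rewrite ?size_polyC_leq1 //; lia.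
have mU : A * 'X - a%:P * B \is monic.
  by rewrite monicE lead_coefDl // -monicE monicMr ?monicX.
have szU : size (A * 'X - a%:P * B) = (n ^ 2).+2 by rewrite size_polyDl.
have szU2 : size ((A * 'X - a%:P * B) ^+ 2) = (n ^ 2).*2.+3.
  have := size_exp (A * 'X - a%:P * B) 2; rewrite szU.
  have := monic_neq0 (monic_exp 2 mU); rewrite -size_poly_gt0.
  by move: (size _) => k; lia.
have lt2 : (size (- (4%:R * b%:P * B * (A + 'X * B)))%R <
            size ((A * 'X - a%:P * B) ^+ 2)%R)%N.
  rewrite szU2 size_polyN ltnS; apply: (@size_leM _ _ (n ^ 2) (n ^ 2).+1); first by lia.
    apply: (@size_leM _ _ 1 (n ^ 2)) => //.
    by apply: (@size_leM _ _ 1 1); rewrite ?size_polyC_leq1 ?size_natr_leq1.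
  apply: size_leD; first by rewrite szA.
  by apply: (@size_leM _ _ 2 (n ^ 2)); rewrite ?size_polyX //; lia.
by rewrite monicE lead_coefDl // -monicE monic_exp // size_polyDl.
Qed.

Lemma size_xQ1 (n : nat) (Q : {poly F} * {poly F}) :
  reduced_fraction n Q -> (size (Q1 Q) <= (n ^ 2).*2.+2)%N.
Proof.
case: Q => A B [_ /= mA szA szB]; rewrite /xQ1.
apply: (@size_leM _ _ 1 (n ^ 2).*2.+2); rewrite ?size_natr_leq1 //.
apply: size_leD.
  apply: (@size_leM _ _ (n ^ 2).+2 (n ^ 2).+1); [lia| |].
    apply: size_leD; first by rewrite size_mulX ?monic_neq0 // szA.
    by apply: (@size_leM _ _ 1 (n ^ 2)); rewrite ?size_polyC_leq1 //; lia.
  apply: size_leD; first by rewrite szA.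
  by apply: (@size_leM _ _ 2 (n ^ 2)); rewrite ?size_polyX //; lia.
apply: (@size_leM _ _ 1 ((n ^ 2).*2)); first by lia.
  by apply: (@size_leM _ _ 1 1); rewrite ?size_polyC_leq1 ?size_natr_leq1.
by rewrite expr2; apply: (@size_leM _ _ (n ^ 2) (n ^ 2)) => //; lia.
Qed.

Hypotheses (two0 : 2%:R != 0 :> F) (ns : nonsingular a b).

(** By Vieta a common zero of C and D over the algebraic closure kills all three coefficients, hence
    both entries of Q by [xQ_no_common_zero], against coprimality. *)
Lemma xnext_reduced (n : nat) (P Q R : {poly F} * {poly F}) :
  reduced_fraction n P -> reduced_fraction n.+1 Q -> xrel P Q R ->
  reduced_fraction n.+2 R.
Proof.
move=> rP rQ [e0 e1 e2]; have [mQ0 szQ0] := reduced_xQ0 rQ.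
have szQ1 := size_xQ1 rQ.
case: P rP e0 e1 e2 => A B [_ /= mA szA szB] e0 e1 e2.
case: R e0 e1 e2 => C D /= e0 e1 e2.
have C0 : C != 0.
  apply: contraTneq mQ0 => C0.
  by rewrite -e0 C0 mul0r monicE lead_coef0 eq_sym oner_eq0.
have A0 := monic_neq0 mA.
(* The degree is 2(n + 1)^2 + 2 - n^2 = (n + 2)^2. *)
have szC : size C = (n.+2 ^ 2).+1.
  have := size_mul C0 A0; rewrite e0 szQ0 szA; move: (size C) => k.
  by rewrite -!mulnn; lia.
have szD : (size D <= n.+2 ^ 2)%N.
  have [->|D0] := eqVneq D 0; first by rewrite size_poly0.
  have := size_mul A0 D0.
  have -> : A * D = Q1 Q - C * B by rewrite -e1; ring.
  have szCB : (size (C * B)%R <= (n.+2 ^ 2).+1 + n ^ 2 - 1)%N.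
    by apply: (@size_leM _ _ (n.+2 ^ 2).+1 (n ^ 2)); rewrite ?szC //; lia.
  have : (size (Q1 Q - C * B)%R <= (n.+1 ^ 2).*2.+2)%N.
    apply: size_leD => //; rewrite size_polyN; apply: leq_trans szCB _.
    by rewrite -!mulnn; lia.
  by rewrite szA; move: (size D) (size _) => k k'; rewrite -!mulnn; lia.
split=> //=; last by rewrite -(monicMr _ mA) e0.
rewrite -(coprimep_map (to_closure F)); apply: Pdiv.ClosedField.root_coprimep => z.
rewrite /root => /eqP Cz; apply/eqP => Dz.
pose ev : {rmorphism {poly F} -> alg_closure F} :=
  GRing.RMorphism.clone _ _ (horner_eval z \o map_poly (to_closure F)) _.
have evE p : ev p = (map_poly (to_closure F) p).[z] by [].
have [q0 q1 q2] := rmorph_xQ ev a%:P b%:P 'X Q.1 Q.2.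
move: (congr1 ev e0) (congr1 ev e1) (congr1 ev e2).
rewrite q0 q1 q2 rmorphD !rmorphM evE Cz [ev D]evE Dz !mul0r !mulr0 addr0.
move=> /esym z0 /esym z1 /esym z2.
have [] := xQ_no_common_zero _ _ z0 z1 z2.
- by rewrite -(rmorph_nat (to_closure F)) fmorph_eq0.
- by rewrite !evE !map_polyC !hornerC nonsingular_map.
have [cQ _ _ _] := rQ.
rewrite !evE => Q1z Q2z; move: cQ; rewrite -(coprimep_map (to_closure F)).
by move=> cQ; have := coprimep_root cQ (introT eqP Q1z); rewrite Q2z eqxx.
Qed.

Lemma xpairS (n : nat) : xpair n.+1 = xnext (xpair n).
Proof. by []. Qed.

Lemma xpair_spec (n : nat) :
  [/\ reduced_fraction n (xpair n).1, reduced_fraction n.+1 (xpair n).2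
    & xrel (xpair n).1 (xpair n).2 (xpair n.+1).2].
Proof.
suff [rP rQ phi] : [/\ reduced_fraction n (xpair n).1,
    reduced_fraction n.+1 (xpair n).2
  & let: (P, Q) := xpair n in
    Q2 Q * P.1 ^+ 2 - Q1 Q * P.1 * P.2 + Q0 Q * P.2 ^+ 2 = 0].
  split=> //; rewrite xpairS; move: rP phi; case: (xpair n) => P Q /= [cP mP _ _].
  by apply: xrelP => //; exact: monic_neq0.
elim: n => [|n [rP rQ phi]].
  split=> /=.
  - by split=> //=; rewrite ?coprimep0 ?eqpxx ?monic1 ?size_poly1 ?size_poly0.
  - by split=> //=; rewrite ?coprimep1 ?monicX ?size_polyX ?size_poly1.
  - by rewrite /xQ2; ring.
rewrite xpairS; move: rP rQ phi; case: (xpair n) => P Q rP rQ phi.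
have [cP mP _ _] := rP; have := xrelP (monic_neq0 mP) cP phi.
have -> : xnext (P, Q) = (Q, (xnext (P, Q)).2) by [].
move: (xnext (P, Q)).2 => R rel; split=> //=; first exact: xnext_reduced rel.
(* By symmetry, Q is a root of the quadratic of R because R is a root of that of Q. *)
rewrite -xQ_sym; case: rel => e0 e1 e2.
by rewrite -e0 -e1 -e2; ring.
Qed.

Lemma xpair_snd (n : nat) : (xpair n).2 = (xpair n.+1).1.
Proof. by rewrite xpairS; case: (xpair n). Qed.

Lemma size_xnum (n : nat) : size (xnum n) = (n ^ 2).+1.
Proof. by have [[]] := xpair_spec n. Qed.

Lemma size_xden_leq (n : nat) : (size (xden n) <= n ^ 2)%N.
Proof. by have [[]] := xpair_spec n. Qed.

Lemma coprimep_xnum_xden (n : nat) : coprimep (xnum n) (xden n).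
Proof. by have [[]] := xpair_spec n. Qed.

Lemma xrel_xnum (n : nat) :
  [/\ xnum n.+2 * xnum n = xQ0 a%:P b%:P 'X (xnum n.+1) (xden n.+1),
      xnum n.+2 * xden n + xnum n * xden n.+2 = xQ1 a%:P b%:P 'X (xnum n.+1) (xden n.+1)
    & xden n * xden n.+2 = xQ2 'X (xnum n.+1) (xden n.+1)].
Proof. by have [_ _] := xpair_spec n; rewrite !xpair_snd. Qed.

Lemma xden_neq0 (n : nat) : (0 < n)%N -> xden n != 0.
Proof.
have cop0 k : xden k = 0 -> (k ^ 2 = 0)%N.
  move=> k0; have := coprimep_xnum_xden k; rewrite k0 coprimep0.
  by move/eqp_size; rewrite size_xnum size_poly1 => -[].
by move=> n0; apply/eqP => /cop0; rewrite -mulnn; lia.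
Qed.

(** The discriminant of the quadratic of index n + 1, computed from its roots of indices n and n +
    2, is a square. Thus [xnum n / xden n] is the abscissa of a point on the twist of the curve by
    its own cubic. *)
Lemma xnum_disc (n : nat) :
  exists t : {poly F}, weierstrass a%:P b%:P 'X *
    (xden n * (xnum n ^+ 3 + a%:P * xnum n * xden n ^+ 2 + b%:P * xden n ^+ 3))
    = t ^+ 2.
Proof.
case: n => [|n]; first by exists 0; rewrite [xden 0]/= mul0r mulr0 expr0n.
exists ((4%:R^-1)%:P * (xnum n.+2 * xden n - xnum n * xden n.+2)).
have four0 : 4%:R != 0 :> F by rewrite (natrM _ 2 2) mulf_neq0.
have fourP : (4%:R : {poly F}) * (4%:R^-1)%:P = 1.
  by rewrite -polyC_natr -polyCM divff.
have [e0 e1 e2] := xrel_xnum n.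
have := xQ_disc a%:P b%:P 'X (xnum n.+1) (xden n.+1).
rewrite -e0 -e1 -e2; set G := weierstrass _ _ _ * _ => eG.
rewrite -[LHS]mul1r -(expr1n _ 2) -fourP.
have -> : (4%:R * (4%:R^-1)%:P) ^+ 2 * G = (4%:R^-1)%:P ^+ 2 * (16%:R * G) :> {poly F} by ring.
by rewrite -eG; ring.
Qed.

End XSequence.

(** * Multiplicities of the zeros of the abscissas *)

Lemma dvdp_mup (K : closedFieldType) (p q : {poly K}) :
  p != 0 -> q != 0 -> (forall z, mup z p <= mup z q)%N -> p %| q.
Proof.
have [r ->] := closed_field_poly_normal p => p0 q0.
rewrite dvdpZl; last by apply: contraNneq p0 => ->; rewrite scale0r.
have lp0 : lead_coef p != 0 by apply: contraNneq p0 => ->; rewrite scale0r.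
have mZ z : mup z (lead_coef p *: \prod_(y <- r) ('X - y%:P)) = count_mem z r.
  by rewrite -mul_polyC mupMr ?rootC // mu_prod_XsubC.
move=> le_mup; have {mZ}: forall z, (count_mem z r <= mup z q)%N.
  by move=> z; rewrite -mZ.
elim: r q q0 {p0 le_mup} => [|y r IHr] q q0 le_mup; first by rewrite big_nil dvd1p.
have /dvdpP[q1 eq1] : 'X - y%:P %| q.
  by rewrite XsubC_dvd //; apply: leq_trans (le_mup y); rewrite /= eqxx.
have q10 : q1 != 0 by apply: contraNneq q0 => q10; rewrite eq1 q10 mul0r.
rewrite big_cons eq1 mulrC dvdp_mul // IHr // => z.
have := le_mup z; rewrite eq1 mupM ?polyXsubC_eq0 // (@mup_XsubCX _ 1) /=.
by case: (y == z); lia.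
Qed.

Lemma eqp_mup (K : closedFieldType) (p q : {poly K}) :
  p != 0 -> q != 0 -> (forall z, mup z p = mup z q) -> p %= q.
Proof. by move=> p0 q0 e; apply/andP; split; apply: dvdp_mup => // z; rewrite e. Qed.

Lemma mupX (K : fieldType) (z : K) (p : {poly K}) (n : nat) :
  p != 0 -> mup z (p ^+ n) = (n * mup z p)%N.
Proof.
move=> p0; elim: n => [|n IHn]; first by rewrite expr0 mupNroot ?rootC ?oner_eq0.
by rewrite exprS mupM ?expf_neq0 // IHn mulSn.
Qed.

Lemma dvdp_deriv_expS (K : fieldType) (p q : {poly K}) (n : nat) :
  p ^+ n.+1 %| q -> p ^+ n %| q^`().
Proof.
case/dvdpP => r ->; rewrite derivM deriv_exp /= exprS.
apply: dvdp_add; first by rewrite mulrA dvdp_mull.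
by rewrite -mulr_natr !mulrA; apply: dvdp_mulr; apply: dvdp_mull.
Qed.

Section PthPowers.

Variables (K : closedFieldType) (p : nat).
Hypothesis pK : p \in [pchar K].

Lemma closed_pth_root (c : K) : exists x, x ^+ p = c.
Proof.
have p0 := prime_gt0 (pcharf_prime pK).
have /closed_rootP[x] : size ('X^p - c%:P) != 1%N.
  by rewrite size_XnsubC // eqSS -lt0n.
by rewrite /root !hornerE subr_eq0 => /eqP; exists x.
Qed.

Lemma pchar_polyK : p \in [pchar {poly K}].
Proof. by rewrite pchar_poly. Qed.

(** Only exponents divisible by p occur, coefficients have p-th roots, and p-th powers add. *)
Lemma deriv0_pth_power (f : {poly K}) : f^`() = 0 -> exists f1, f = f1 ^+ p.
Proof.
move=> f'0; rewrite -[f]coefK poly_def.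
elim/big_rec: _ => [|i u _ [v ->]].
  by exists 0; rewrite expr0n gtn_eqF // prime_gt0 // (pcharf_prime pK).
have [w ->] : exists w, f`_i *: 'X^i = w ^+ p.
  case: (boolP (p %| i)%N) => [/dvdnP[k ->]|pi].
    have [c <-] := closed_pth_root f`_(k * p); exists (c *: 'X^k).
    by rewrite exprZn exprM.
  exists 0; suff -> : f`_i = 0.
    by rewrite scale0r expr0n gtn_eqF // prime_gt0 // (pcharf_prime pK).
  case: (i : nat) pi => [|k] pk; first by rewrite dvdn0 in pk.
  have := congr1 (fun q : {poly K} => q`_k) f'0.
  rewrite coef_deriv coef0 -mulr_natr => /eqP.
  by rewrite mulf_eq0 -(dvdn_pcharf pK) (negPf pk) orbF => /eqP.
exists (w + v); rewrite exprDn_pchar //.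
by rewrite (eq_pnat _ (pcharf_eq pchar_polyK)) pnat_id // (pcharf_prime pK).
Qed.

End PthPowers.

(** * The binary quartic of the curve and the Wronskian *)

Section Quartic.

Variables (R : comNzRingType) (a b A B : R).

(** The homogeneous form of B^4 times the cubic at A/B, followed by its partial derivatives in A and
    in B. *)
Definition quartic : R := B * (A ^+ 3 + a * A * B ^+ 2 + b * B ^+ 3).
Definition quarticA : R := B * (3%:R * A ^+ 2 + a * B ^+ 2).
Definition quarticB : R := A ^+ 3 + 3%:R * a * A * B ^+ 2 + 4%:R * b * B ^+ 3.

End Quartic.

Lemma rmorph_quartic (R S : comNzRingType) (phi : {rmorphism R -> S}) (a b A B : R) :
  phi (quartic a b A B) = quartic (phi a) (phi b) (phi A) (phi B).
Proof. by rewrite /quartic !(rmorphXn, rmorphM, rmorphD). Qed.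

Section Wronskian.

Variables (K : closedFieldType) (a b : K) (A B : {poly K}).
Local Notation qF := (quartic a%:P b%:P A B).
Local Notation W := (A^`() * B - A * B^`()).

(** The chain rule for the derivative of the quartic, combined with Euler's identity for a form of
    degree 4. *)
Lemma quartic_wronskian :
  quarticA a%:P A B * W = B * qF^`() - 4%:R * qF * B^`() /\
  quarticB a%:P b%:P A B * W = 4%:R * qF * A^`() - A * qF^`().
Proof.
by rewrite /quarticA /quarticB /quartic !(derivM, derivD, deriv_exp, derivC) /=; split; ring.
Qed.

Hypotheses (ns : nonsingular a b) (cAB : coprimep A B).

(** Smoothness: the quartic has no repeated projective root. Where B vanishes its B-derivative is
    A^3; elsewhere the derivative of the cubic at A/B is nonzero. *)
Lemma quartic_grad_neq0 (z : K) : qF.[z] = 0 ->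
  (quarticA a%:P A B).[z] != 0 \/ (quarticB a%:P b%:P A B).[z] != 0.
Proof.
rewrite /quartic /quarticA /quarticB -!polyC_natr.
rewrite !(horner_exp, hornerM, hornerD, hornerC) => F0.
have [B0|B0] := eqVneq B.[z] 0.
  right; rewrite B0 !expr0n /= !mulr0 !addr0 expf_neq0 //.
  have cBA : coprimep B A by rewrite coprimep_sym.
  by apply: coprimep_root cBA _; apply/eqP.
left; rewrite mulf_neq0 //; have := nonsingular_deriv_neq0 ns (z := A.[z] / B.[z]).
have -> : weierstrass a b (A.[z] / B.[z]) =
    B.[z] * (A.[z] ^+ 3 + a * A.[z] * B.[z] ^+ 2 + b * B.[z] ^+ 3) / B.[z] ^+ 4.
  by rewrite /weierstrass; field.
rewrite F0 mul0r => /(_ erefl); apply: contraNneq => e.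
have -> : 3%:R * (A.[z] / B.[z]) ^+ 2 + a =
    (3%:R * A.[z] ^+ 2 + a * B.[z] ^+ 2) / B.[z] ^+ 2 by field.
by rewrite e mul0r.
Qed.

(* The two identities of quartic_wronskian show that W vanishes at a k-fold
   root of qF to order k - 1 at least; when k = 1 the parity of the order of the
   square g qF makes g vanish there. *)
Lemma dvdp_quartic_wronskian (g s : {poly K}) :
  g != 0 -> qF != 0 -> W != 0 -> g * qF = s ^+ 2 -> qF %| g * W ^+ 2.
Proof.
move=> g0 F0 W0 gF; apply: dvdp_mup => // [|z]; first by rewrite mulf_neq0 ?expf_neq0.
have s0 : s != 0 by apply: contraNneq (mulf_neq0 g0 F0) => s0; rewrite gF s0 expr0n.
have par : (mup z g + mup z qF = 2 * mup z s)%N by rewrite -mupM // gF mupX.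
rewrite (mupM z g0 (expf_neq0 2 W0)) (mupX z 2 W0).
case e : (mup z qF) => [//|k]; rewrite e in par.
suff : (k <= mup z W)%N by lia.
rewrite mup_geq //.
have dF : ('X - z%:P) ^+ k.+1 %| qF by rewrite -mup_geq // e.
have dF' := dvdp_deriv_expS dF.
have dFk : ('X - z%:P) ^+ k %| qF by apply: dvdp_trans dF; apply: dvdp_exp2l.
have Fz : qF.[z] = 0.
  by apply/eqP/negP => /negP/mupNroot; rewrite e.
have [eA eB] := quartic_wronskian.
have cop (q : {poly K}) : q.[z] != 0 -> coprimep (('X - z%:P) ^+ k) q.
  by move=> qz; rewrite coprimep_expl // coprimep_sym coprimep_XsubC.
have [/cop c|/cop c] := quartic_grad_neq0 Fz; rewrite -(Gauss_dvdpr _ c).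
  rewrite eA; apply: dvdp_sub; first exact: dvdp_mull.
  by apply: dvdp_mulr; apply: dvdp_mull.
rewrite eB; apply: dvdp_sub; last exact: dvdp_mull.
by apply: dvdp_mulr; apply: dvdp_mull.
Qed.

Lemma size_quartic : B != 0 -> (size B < size A)%N ->
  (size qF = (3 * (size A).-1 + size B))%N.
Proof.
move=> B0 BA; have A0 : A != 0 by rewrite -size_poly_gt0; apply: leq_ltn_trans BA.
have szX (q : {poly K}) n : q != 0 -> size (q ^+ n) = ((size q).-1 * n).+1.
  by move=> q0; rewrite -size_exp prednK // size_poly_gt0 expf_neq0.
have szB : (0 < size B)%N by rewrite size_poly_gt0.
have szG : size (A ^+ 3 + (a%:P * A * B ^+ 2 + b%:P * B ^+ 3)) = ((size A).-1 * 3).+1.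
  rewrite size_polyDl szX // ltnS; apply: leq_trans (size_polyD _ _) _.
  rewrite geq_max !mul_polyC -!scalerAl; apply/andP; split;
    apply: leq_trans (size_scale_leq _ _) _.
    by apply: leq_trans (size_polyMleq _ _) _; rewrite szX //; lia.
  by rewrite szX //; lia.
rewrite /quartic -addrA size_mul ?szG; first by rewrite addnS /= addnC mulnC.
  by [].
by rewrite -size_poly_gt0 szG.
Qed.

(** As deg B < deg A, the degree of g W^2 is at most that of the quartic dividing it, so they are
    associates. A double zero of A is a zero of W, hence of the quartic, which is b B^4 modulo A;
    then A and B share a zero. *)
Lemma wronskian_simple_root (g s : {poly K}) : b != 0 ->
  g != 0 -> (size g <= 4)%N -> (0 < size B < size A)%N -> W != 0 ->
  g * qF = s ^+ 2 -> forall z, (mup z A <= 1)%N.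
Proof.
move=> b0 g0 g4 /andP[B_gt0 BA] W0 gF z.
have B0 : B != 0 by rewrite -size_poly_gt0.
have A0 : A != 0 by rewrite -size_poly_gt0; apply: leq_ltn_trans BA.
have szF := size_quartic B0 BA.
have F0 : qF != 0 by rewrite -size_poly_gt0 szF; lia.
have gW0 : g * W ^+ 2 != 0 by rewrite mulf_neq0 ?expf_neq0.
have dFW := dvdp_quartic_wronskian g0 F0 W0 gF.
have szW : (size W <= (size A + size B).-2)%N.
  have dA : (size A^`()%R < size A)%N by apply: lt_size_deriv.
  have dB : (size B^`()%R < size B)%N by apply: lt_size_deriv.
  have mA : (size (A^`() * B)%R <= (size A^`()%R + size B).-1)%N by apply: size_polyMleq.
  have mB : (size (A * B^`())%R <= (size A + size B^`()%R).-1)%N by apply: size_polyMleq.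
  apply: leq_trans (size_polyD _ _) _; rewrite size_polyN geq_max.
  by apply/andP; split; [apply: leq_trans mA _|apply: leq_trans mB _]; move: dA dB; clear; lia.
have eqFW : qF %= g * W ^+ 2.
  rewrite -dvdp_size_eqp // eqn_leq (dvdp_leq gW0 dFW) /= szF.
  have szW2 : (size (W ^+ 2) <= (size W).-1 * 2 + 1)%N.
    by rewrite addn1; apply: size_poly_exp_leq.
  apply: leq_trans (size_polyMleq _ _) _.
  have : (0 < size W)%N by rewrite size_poly_gt0.
  by move: szW2 szW; clear -g4 BA; lia.
rewrite leqNgt; apply/negP; rewrite mup_geq // => dA2.
have dA : 'X - z%:P %| A by apply: dvdp_trans dA2; rewrite expr2; exact: dvdp_mulIl.
have dA' := dvdp_deriv_expS dA2; rewrite expr1 in dA'.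
have dF : 'X - z%:P %| qF.
  rewrite (eqp_dvdr _ eqFW); apply: dvdp_mull; rewrite expr2; apply: dvdp_mull.
  by apply: dvdp_sub; apply: dvdp_mulr.
move: dF dA; rewrite !dvdp_XsubCl => /eqP; rewrite /quartic.
rewrite !(horner_exp, hornerM, hornerD, hornerC) => Fz Az.
have := coprimep_root cAB Az; move: Fz; rewrite (eqP Az).
rewrite expr0n /= mulr0 mul0r !add0r mulrCA -exprS => /eqP.
by rewrite mulf_eq0 (negPf b0) expf_eq0 /= => ->.
Qed.

End Wronskian.

(** Coprimality makes A divide its own derivative, which has smaller degree. *)
Lemma deriv_ratio_eq0 (K : fieldType) (A B : {poly K}) :
  coprimep A B -> (size B < size A)%N -> A^`() * B = A * B^`() ->
  A^`() = 0 /\ B^`() = 0.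
Proof.
move=> cAB BA eW.
have A0 : A != 0 by rewrite -size_poly_gt0; apply: leq_ltn_trans BA.
have A'0 : A^`() = 0.
  have dA : A %| A^`() by rewrite -(Gauss_dvdpl _ cAB) eW dvdp_mulIl.
  apply/eqP; apply: contraTT dA => A'0; apply/negP => /(dvdp_leq A'0).
  by rewrite leqNgt lt_size_deriv.
split=> //; apply: (mulfI A0); rewrite -eW A'0 mul0r mulr0 //.
Qed.

Lemma sqr_of_odd_pow_sqr (K : fieldType) (p : nat) (Y t : {poly K}) :
  odd p -> Y ^+ p = t ^+ 2 -> exists t1, Y = t1 ^+ 2.
Proof.
move=> op eY; have [->|Y0] := eqVneq Y 0; first by exists 0; rewrite expr0n.
have ep : p = (p./2 * 2).+1 by rewrite muln2 -[LHS]odd_double_half op.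
have /dvdpP[t1 et] : Y ^+ p./2 %| t.
  by rewrite -(@dvdp_pexp2r _ _ _ 2) // -eY -exprM [in X in _ %| X]ep exprS dvdp_mulIr.
exists t1; apply: (mulfI (expf_neq0 (p./2 * 2) Y0)).
by rewrite -exprSr -ep eY et exprMn exprM mulrC.
Qed.

(** * Descent along Frobenius *)

Section Descent.

Variables (K : closedFieldType) (p : nat).
Hypotheses (pK : p \in [pchar K]) (op : odd p).

(* A / B is the abscissa of a point of the curve over K(X) twisted by g.
   If its derivative is not 0, then degrees force g W^2 to be a constant
   multiple of the quartic, where W = A' B - A B', so W does not vanish at the
   zeros of A; otherwise the point is the Frobenius image of a point on the
   curve with coefficients the p-th roots of a and b. *)
Lemma numerator_pth_power (n : nat) (a b : K) (g A B s : {poly K}) :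
  g != 0 -> (size g <= 4)%N -> nonsingular a b -> b != 0 ->
  coprimep A B -> (size B < size A)%N -> (size A <= n)%N ->
  g * quartic a%:P b%:P A B = s ^+ 2 ->
  exists j, exists w, A = w ^+ (p ^ j) /\ forall z, (mup z w <= 1)%N.
Proof.
move=> g0 g4; have p_pr := pcharf_prime pK; have p1 := prime_gt1 p_pr.
have pP := pchar_polyK pK.
elim: n a b A B s => [|n IHn] a b A B s ns b0 cAB BA An gF.
  by move: BA; rewrite ltnNge (leq_trans An).
have A0 : A != 0 by rewrite -size_poly_gt0; apply: leq_ltn_trans BA.
have [A1|A1] := leqP (size A) 1.
  exists 0, A; rewrite expn0 expr1; split=> // z.
  rewrite mupNroot // (size1_polyC A1) rootC.
  by apply: contraNneq A0 => e; rewrite (size1_polyC A1) e.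
have B0 : B != 0.
  by apply: contraTneq cAB => ->; rewrite coprimep0 -size_poly_eq1 neq_ltn A1 orbT.
have [W0|W0] := eqVneq (A^`() * B - A * B^`()) 0; last first.
  exists 0, A; rewrite expn0 expr1; split=> // z.
  have szBA : (0 < size B < size A)%N by rewrite size_poly_gt0 B0.
  exact: (wronskian_simple_root ns cAB b0 g0 g4 szBA W0 gF).
move/eqP: W0; rewrite subr_eq0 => /eqP /(deriv_ratio_eq0 cAB BA)[A'0 B'0].
have [A2 eA] := deriv0_pth_power pK A'0; have [B2 eB] := deriv0_pth_power pK B'0.
have [a2 ea] := closed_pth_root pK a; have [b2 eb] := closed_pth_root pK b.
have szp (q : {poly K}) : q ^+ p != 0 -> size (q ^+ p) = ((size q).-1 * p).+1.
  by move=> q0; rewrite -size_exp prednK // size_poly_gt0.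
have A20 : A2 ^+ p != 0 by rewrite -eA.
have B20 : B2 ^+ p != 0 by rewrite -eB.
have szA : size A = ((size A2).-1 * p).+1 by rewrite eA szp.
have szB : size B = ((size B2).-1 * p).+1 by rewrite eB szp.
have eF : quartic a%:P b%:P A B = quartic a2%:P b2%:P A2 B2 ^+ p.
  have := rmorph_quartic (pFrobenius_aut pP) a2%:P b2%:P A2 B2.
  by rewrite /= !pFrobenius_autE -!polyC_exp ea eb -eA -eB.
(* The p-th power of the left side is g^(p-1) s^2, a square because p is odd; an odd exponent can
   then be removed. *)
have [t et] : exists t1, g * quartic a2%:P b2%:P A2 B2 = t1 ^+ 2.
  apply: (@sqr_of_odd_pow_sqr _ p _ (s * g ^+ p./2)) => //.
  rewrite exprMn -eF exprMn -gF -exprM muln2.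
  have -> : g ^+ p = g * g ^+ p./2.*2.
    by rewrite -exprS; congr (_ ^+ _); rewrite -[LHS]odd_double_half op.
  ring.
have ns2 : nonsingular a2 b2.
  rewrite -(nonsingular_map (pFrobenius_aut pK)) /= !pFrobenius_autE ea eb //.
have b20 : b2 != 0.
  by apply: contraNneq b0 => e; rewrite -eb e expr0n gtn_eqF // prime_gt0.
have cAB2 : coprimep A2 B2.
  by move: cAB; rewrite eA eB coprimep_pexpl ?prime_gt0 // coprimep_pexpr ?prime_gt0.
have A2gt : (0 < size A2)%N.
  by rewrite size_poly_gt0; apply: contraNneq A0 => e; rewrite eA e expr0n gtn_eqF // prime_gt0.
have [j [w [ew mw]]] : exists j, exists w, A2 = w ^+ (p ^ j) /\ forall z, (mup z w <= 1)%N.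
  apply: (IHn a2 b2 A2 B2 t) => //.
    have : ((size B2).-1 < (size A2).-1)%N.
      by move: BA; rewrite szA szB ltnS ltn_pmul2r // prime_gt0.
    by clear; lia.
  by move: An A1; rewrite szA; move: (size A2) A2gt p1 => k; clear; nia.
exists j.+1, w; split=> //.
by rewrite eA ew -exprM expnSr.
Qed.

End Descent.

Section NonSquare.

Variables (F : finFieldType) (a b : F) (p : nat).
Hypotheses (oF : odd #|F|) (ns : nonsingular a b) (b0 : b != 0).
Hypothesis pF : p \in [pchar F].

Local Notation K := (alg_closure F).
Local Notation phi := (map_poly (to_closure F)).

Lemma pchar_closure : p \in [pchar K].
Proof. by rewrite (fmorph_pchar (to_closure F)). Qed.

Lemma odd_pchar : odd p.
Proof.
apply: contraLR oF => ep; rewrite -dvdn2 in ep *.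
have /eqP p2 : 2%N == p by rewrite -dvdn_prime2 // ?(pcharf_prime pF).
by rewrite -dvdn2 p2 natr_dvd_card.
Qed.

Lemma natr2_neq0 : 2%:R != 0 :> F.
Proof. by apply: coprime_card_natr_neq0 => //; rewrite coprimen2. Qed.

Lemma weierstrass_poly_neq0_size :
  weierstrass a%:P b%:P 'X != 0 :> {poly F} /\
  size (weierstrass a%:P b%:P 'X : {poly F}) = 4%N.
Proof.
have sz : size (weierstrass a%:P b%:P 'X : {poly F}) = 4%N.
  rewrite /weierstrass -addrA size_polyDl size_polyXn // ltnS.
  apply: leq_trans (size_polyD _ _) _; rewrite geq_max; apply/andP; split.
    by apply: (@size_leM _ _ _ 1 2); rewrite ?size_polyC_leq1 ?size_polyX.
  by apply: leq_trans (size_polyC_leq1 _) _.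
by rewrite -size_poly_eq0 sz.
Qed.

Lemma xnum_pth_power (n : nat) : (0 < n)%N ->
  exists j, exists w, phi (xnum a b n) = w ^+ (p ^ j) /\ forall z, (mup z w <= 1)%N.
Proof.
move=> n0; have [t et] := xnum_disc natr2_neq0 ns n.
have [g0 sg] := weierstrass_poly_neq0_size.
have := congr1 phi et; rewrite rmorphM rmorphXn => eK.
apply: (@numerator_pth_power K p pchar_closure odd_pchar _
  (to_closure F a) (to_closure F b) (phi (weierstrass a%:P b%:P 'X)) _
  (phi (xden a b n)) (phi t) _ _ _ _ _ _ (leqnn _)).
- by rewrite map_poly_eq0.
- by rewrite size_map_poly sg.
- by rewrite nonsingular_map.
- by rewrite fmorph_eq0.
- by rewrite coprimep_map coprimep_xnum_xden //; apply: natr2_neq0.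
- rewrite !size_map_poly (size_xnum natr2_neq0 ns) ltnS.
  exact: size_xden_leq natr2_neq0 ns n.
by rewrite -[RHS]eK -/(quartic _ _ _ _) rmorph_quartic /= !map_polyC.
Qed.

(** The zeros of the two numerators have the odd multiplicities p^i and p^j. In a square the
    parities must match, so both squarefree parts have the same zeros; comparing degrees gives the
    relation. *)
Lemma xnumM_const_sqr (m n : nat) : (0 < m)%N -> (0 < n)%N ->
  const_sqr (xnum a b m * xnum a b n) ->
  exists i, exists j, (n ^ 2 * p ^ i = m ^ 2 * p ^ j)%N.
Proof.
move=> m0 n0 [c [u eu]].
have [i [w [ew mw]]] := xnum_pth_power m0.
have [j [v [ev mv]]] := xnum_pth_power n0.
have nz k : xnum a b k != 0.
  by rewrite -size_poly_gt0 (size_xnum natr2_neq0 ns).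
have := congr1 phi eu; rewrite -mul_polyC !rmorphM /= map_polyC /= => eK.
have c0 : c != 0.
  by apply: contraNneq (mulf_neq0 (nz m) (nz n)) => c0; rewrite eu c0 scale0r.
have u0 : phi u != 0.
  rewrite map_poly_eq0; apply: contraNneq (mulf_neq0 (nz m) (nz n)) => u0.
  by rewrite eu u0 expr0n scaler0.
have pp k : (0 < p ^ k)%N by rewrite expn_gt0 prime_gt0 // (pcharf_prime pF).
have w0 : w != 0.
  have : phi (xnum a b m) != 0 by rewrite map_poly_eq0.
  by rewrite ew; apply: contraNneq => ->; rewrite expr0n gtn_eqF.
have v0 : v != 0.
  have : phi (xnum a b n) != 0 by rewrite map_poly_eq0.
  by rewrite ev; apply: contraNneq => ->; rewrite expr0n gtn_eqF.
have /eqp_size wv : w %= v.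
  apply: eqp_mup => // z; have := congr1 (mup z) eK.
  rewrite ew ev -expr2 mupM ?expf_neq0 // !mupX // mupMr ?rootC ?fmorph_eq0 // mupX //.
  have := mw z; have := mv z; have := oddX p i; have := oddX p j.
  rewrite odd_pchar !orbT; move: (p ^ i)%N (p ^ j)%N => P Q.
  case: (mup z w) => [|[]] //; case: (mup z v) => [|[]] // oP oQ _ _;
    rewrite ?muln0 ?muln1 ?add0n ?addn0 => /(congr1 odd); rewrite ?oddM ?oP ?oQ //.
have szX (q : {poly K}) k : q != 0 -> size (q ^+ k) = ((size q).-1 * k).+1.
  by move=> q0; rewrite -size_exp prednK // size_poly_gt0 expf_neq0.
have := congr1 (fun q : {poly K} => size q) ew.
have := congr1 (fun q : {poly K} => size q) ev.
rewrite /= !szX // !size_map_poly !(size_xnum natr2_neq0 ns) wv => -[->] [->].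
by exists i, j; rewrite -!mulnA [(p ^ i * _)%N]mulnC.
Qed.

End NonSquare.

(** The bound on the exponent makes the existential boolean; it is harmless since s < p^s. *)
Definition pow_multiple (p m n : nat) : bool := [exists s : 'I_n.+1, n == (p ^ s * m)%N].

Lemma pow_multipleP (p m n s : nat) : (1 < p)%N -> (0 < m)%N ->
  n = (p ^ s * m)%N -> pow_multiple p m n.
Proof.
move=> p1 m0 e; have sn : (s < n.+1)%N.
  by rewrite ltnS e; apply: leq_trans (ltnW (ltn_expl s p1)) _; rewrite leq_pmulr.
by apply/existsP; exists (Ordinal sn); rewrite /= -e.
Qed.

(** The prime-to-p parts of m and n have equal squares, hence agree. *)
Lemma eq_sqr_mul_pow (p m n i j : nat) : prime p -> (0 < m)%N -> (0 < n)%N ->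
  (n ^ 2 * p ^ i = m ^ 2 * p ^ j)%N -> pow_multiple p m n || pow_multiple p n m.
Proof.
move=> pr m0 n0 e; have p1 := prime_gt1 pr.
have p'p k : ((p ^ k)`_p^' = 1)%N.
  by apply: part_p'nat; rewrite pnatNK pnatX pnat_id.
have e' : (n`_p^' = m`_p^')%N.
  have := congr1 (fun k => k`_p^')%N e.
  rewrite /= !partnM ?expn_gt0 ?n0 ?m0 ?prime_gt0 // !p'p !muln1 !mulnn => /eqP.
  by rewrite eqn_exp2r // => /eqP.
have dec k : (0 < k)%N -> k = (p ^ logn p k * k`_p^')%N.
  by move=> k0; rewrite -p_part partnC.
have [le|/ltnW le] := leqP (logn p m) (logn p n); apply/orP; [left|right].
  apply: (@pow_multipleP _ _ _ (logn p n - logn p m)) => //.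
  by rewrite {1}(dec n n0) {2}(dec m m0) mulnA -expnD subnK // e'.
apply: (@pow_multipleP _ _ _ (logn p m - logn p n)) => //.
by rewrite {1}(dec m m0) {2}(dec n n0) mulnA -expnD subnK // e'.
Qed.

Lemma rmorph_weierstrass (R S : comNzRingType) (phi : {rmorphism R -> S}) (a b x : R) :
  phi (weierstrass a b x) = weierstrass (phi a) (phi b) (phi x).
Proof. by rewrite /weierstrass !(rmorphXn, rmorphM, rmorphD). Qed.

(** * Nonvanishing of the numerators at points of order two *)

Section TwoTorsion.

Variables (F : finFieldType) (a b : F).
Hypotheses (two0 : 2%:R != 0 :> F) (ns : nonsingular a b) (b0 : b != 0).

Local Notation K := (alg_closure F).
Local Notation phi := (map_poly (to_closure F)).

Lemma xrel_at (R : comNzRingType) (ev : {rmorphism {poly F} -> R}) (n : nat) :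
  let A k := ev (xnum a b k) in let B k := ev (xden a b k) in
  [/\ A n.+2 * A n = xQ0 (ev a%:P) (ev b%:P) (ev 'X) (A n.+1) (B n.+1),
      A n.+2 * B n + A n * B n.+2 = xQ1 (ev a%:P) (ev b%:P) (ev 'X) (A n.+1) (B n.+1)
    & B n * B n.+2 = xQ2 (ev 'X) (A n.+1) (B n.+1)].
Proof.
have [q0 q1 q2] := rmorph_xQ ev a%:P b%:P 'X (xnum a b n.+1) (xden a b n.+1).
have [e0 e1 e2] := xrel_xnum two0 ns n.
by rewrite /= -q0 -q1 -q2 -e0 -e1 -e2 rmorphD !rmorphM.
Qed.

(* (z, 0) has order 2, so n (z, 0) is the origin or (z, 0), whose abscissa z
   is not 0. *)
Lemma xnum_root_weierstrass (z : K) :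
  weierstrass (to_closure F a) (to_closure F b) z = 0 ->
  forall n, (phi (xnum a b n)).[z] != 0.
Proof.
move=> gz; pose ev : {rmorphism {poly F} -> K} :=
  GRing.RMorphism.clone _ _ (horner_eval z \o phi) _.
have evE q : (phi q).[z] = ev q by [].
have evX : ev 'X = z by rewrite -evE map_polyX hornerX.
have evC c : ev c%:P = to_closure F c by rewrite -evE map_polyC hornerC.
have cop n : ev (xnum a b n) = 0 -> ev (xden a b n) = 0 -> False.
  move=> /eqP An Bn; have := coprimep_xnum_xden two0 ns n.
  rewrite -(coprimep_map (to_closure F)) => c.
  by have := coprimep_root c An; rewrite evE Bn eqxx.
have z0 : z != 0.
  apply: contra_neq b0 => z0; apply: (fmorph_inj (to_closure F)).
  by rewrite rmorph0 -gz z0 /weierstrass expr0n mulr0 !add0r.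
(* Even multiples are at infinity, odd ones have abscissa z. *)
have inv k : ev (xden a b k.*2) = 0 /\ ev (xnum a b k.*2.+1) = z * ev (xden a b k.*2.+1).
  elim: k => [|k [IH0 IH1]].
    by rewrite [xnum _ _ _]/= [xden _ _ 1]/= [xden _ _ _]/= !rmorph0 rmorph1 evX mulr1.
  have A0 : ev (xnum a b k.*2) != 0 by apply/eqP => /cop; apply.
  have B1 : ev (xden a b k.*2.+1) != 0.
    by apply/eqP => e; apply: (cop k.*2.+1) => //; rewrite IH1 e mulr0.
  have [e0 e1 e2] := xrel_at ev k.*2.
  have B2 : ev (xden a b k.*2.+2) = 0.
    apply: (mulfI A0); rewrite mulr0; move: e1; rewrite IH0 mulr0 add0r => ->.
    rewrite IH1 evX !evC (_ : xQ1 _ _ _ _ _ =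
      4%:R * ev (xden a b k.*2.+1) ^+ 2 * weierstrass (to_closure F a) (to_closure F b) z).
      by rewrite gz mulr0.
    by rewrite /xQ1 /weierstrass; ring.
  split; rewrite doubleS //.
  have [f0 f1 f2] := xrel_at ev k.*2.+1.
  apply: (mulfI (mulf_neq0 z0 B1)); rewrite -{1}IH1 mulrC f0.
  rewrite mulrACA -expr2 f2 B2 evX /xQ0 /xQ2; ring.
move=> n; rewrite evE; apply/eqP => An; rewrite -(odd_double_half n) in An.
have [B0 A1] := inv n./2; case: (odd n) An; rewrite ?add0n ?add1n => An.
  by apply: (cop _ An); apply/eqP; move/eqP: An; rewrite A1 mulf_eq0 (negPf z0).
exact: (cop _ An).
Qed.

(** A root of the cubic is simple and is no zero of either numerator, so its multiplicity in the
    product is 1, which is odd. *)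
Lemma weierstrassM_nconst_sqr (m n : nat) :
  ~ const_sqr (weierstrass a%:P b%:P 'X * (xnum a b m * xnum a b n)).
Proof.
case=> c [u eu]; pose g : {poly F} := weierstrass a%:P b%:P 'X; rewrite -/g in eu.
have [g0 sg] : g != 0 /\ size g = 4%N by apply: weierstrass_poly_neq0_size.
have [z /rootP gz] : exists z, root (phi g) z.
  by apply/closed_rootP; rewrite size_map_poly sg.
have wz : weierstrass (to_closure F a) (to_closure F b) z = 0.
  rewrite -gz; pose ev : {rmorphism {poly F} -> K} :=
    GRing.RMorphism.clone _ _ (horner_eval z \o phi) _.
  rewrite -[RHS]/(ev g) rmorph_weierstrass /= !map_polyC map_polyX.
  by rewrite /= !horner_evalE !hornerC hornerX.
have nz k : (phi (xnum a b k)).[z] != 0 by apply: xnum_root_weierstrass.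
have nzp k : phi (xnum a b k) != 0.
  by apply: contraNneq (nz k) => ->; rewrite horner0.
have gK0 : phi g != 0 by rewrite map_poly_eq0.
have nzr k : ~~ root (phi (xnum a b k)) z by rewrite /root.
have eK : phi g * (phi (xnum a b m) * phi (xnum a b n)) = (to_closure F c)%:P * phi u ^+ 2.
  by rewrite -map_polyC -rmorphXn -!rmorphM /= eu mul_polyC.
have m1 : mup z (phi g) = 1%N.
  apply/eqP; rewrite eqn_leq mup_geq // expr1 dvdp_XsubCl /root gz eqxx andbT.
  rewrite leqNgt mup_geq //; apply/negP => /dvdp_deriv_expS.
  have -> : (phi g)^`() = (3%:R : K)%:P * 'X ^+ 2 + (to_closure F a)%:P.
    have gd : g^`() = (3%:R)%:P * 'X^2 + a%:P.
      rewrite /g /weierstrass !(derivD, derivM, derivC, derivXn, derivX) /= polyC_natr.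
      ring.
    by rewrite deriv_map gd rmorphD rmorphM /= map_polyXn !map_polyC /= rmorph_nat.
  rewrite expr1 dvdp_XsubCl /root !(hornerXn, hornerD, hornerM, hornerC).
  have nsK : nonsingular (to_closure F a) (to_closure F b) by rewrite nonsingular_map.
  by apply/negP/(nonsingular_deriv_neq0 nsK wz).
have := congr1 (mup z) eK.
rewrite mulrC mupMr; last by rewrite rootM negb_or !nzr.
rewrite m1; have lhs0 := mulf_neq0 gK0 (mulf_neq0 (nzp m) (nzp n)).
have c0 : c != 0 by apply: contraNneq lhs0 => e; rewrite eK e rmorph0 polyC0 mul0r.
have u0 : phi u != 0 by apply: contraNneq lhs0 => e; rewrite eK e expr0n mulr0.
rewrite mupMr ?rootC ?fmorph_eq0 // mupX //; lia.
Qed.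

End TwoTorsion.

(** * Specialization at rational points *)

Section Specialization.

Variables (F : finFieldType) (a b : F) (x0 y0 : F).
Hypotheses (oF : odd #|F|) (two0 : 2%:R != 0 :> F) (ns : nonsingular a b).
Hypothesis curve0 : on_curve a b (Some (x0, y0)).

Local Notation A n := ((xnum a b n).[x0]).
Local Notation B n := ((xden a b n).[x0]).
Local Notation P := (EC curve0).

Lemma xrel_at_point (n : nat) :
  [/\ A n.+2 * A n = xQ0 a b x0 (A n.+1) (B n.+1),
      A n.+2 * B n + A n * B n.+2 = xQ1 a b x0 (A n.+1) (B n.+1)
    & B n * B n.+2 = xQ2 x0 (A n.+1) (B n.+1)].
Proof.
have := xrel_at two0 ns (horner_eval x0) n.
by rewrite /= !horner_evalE !hornerC hornerX.
Qed.

(* The slope l is that of the line through P, (n-1) P and - n P. *)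
Definition point_state (n : nat) : Prop :=
  exists y l, [/\ ecval (ec_muln n P) = Some (A n / B n, y),
    y + y0 = - (l * (A n / B n - x0)),
    l ^+ 2 = A n / B n + x0 + A n.-1 / B n.-1
  & (exists2 t, t != 0 & B n = t ^+ 2) /\ (exists2 t, t != 0 & B n.-1 = t ^+ 2)].

Lemma A1_B1 : A 1 = x0 /\ B 1 = 1.
Proof. by rewrite /xnum /xden /= hornerX hornerC. Qed.

(** The tangent at P gives the slope, and the denominator is (2 y0)^2. *)
Lemma point_state2 : B 2 != 0 -> point_state 2.
Proof.
have [A1 B1] := A1_B1; have [e0 e1 e2] := xrel_at_point 0.
have B0 : B 0 = 0 by rewrite /xden /= horner0.
move=> B20; move: e0 e1; rewrite A1 B1 mulr1 B0 mulr0 add0r mul1r => e0 e1.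
move/eqP: (curve0) => yx.
have B2y : B 2 = (2%:R * y0) ^+ 2.
  by rewrite e1 exprMn yx /xQ1; ring.
have y0n : y0 != 0.
  by apply: contraNneq B20 => e; rewrite B2y e mulr0 expr0n.
pose l := (3%:R * x0 ^+ 2 + a) / (2%:R * y0); pose x3 := l ^+ 2 - x0 - x0.
have y20 : 2%:R * y0 != 0 by rewrite mulf_neq0.
have x3E : A 2 / B 2 = x3.
  rewrite e0 B2y /x3 /l.
  have -> : b = y0 ^+ 2 - x0 ^+ 3 - a * x0 by rewrite yx; ring.
  by rewrite /xQ0; field; rewrite two0 y0n.
exists (l * (x0 - x3) - y0), l; rewrite /= x3E; split.
- have -> : (y0 == - y0) = false.
    by apply/negbTE; apply: contraNneq y20 => e; rewrite mulr_natl mulr2n {1}e addNr.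
  by rewrite eqxx.
- ring.
- by rewrite A1 B1 divr1 /x3; ring.
by rewrite B1; split; [exists (2%:R * y0)|exists 1; rewrite ?oner_neq0 ?expr1n].
Qed.

(** Vieta gives the sum of the neighbouring abscissas. The previous one is that of the chord through
    -P, by the stored slope, so the next one is that of the chord through P, which is the addition
    formula. *)
Lemma point_stateS (n : nat) :
  B n.+3 != 0 -> point_state n.+2 -> point_state n.+3.
Proof.
move=> B30 [y [l [ePn yl ll [[t t0 et] [u u0 eu]]]]].
have [e0 e1 e2] := xrel_at_point n.+1.
have yx : y0 ^+ 2 = x0 ^+ 3 + a * x0 + b by apply/eqP.
have := ecvalP (ec_muln n.+2 P); rewrite ePn => /eqP yn.
have B20 : B n.+2 != 0 by rewrite et expf_neq0.
have B10 : B n.+1 != 0 by rewrite [B n.+1]eu expf_neq0.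
have d0 : A n.+2 - x0 * B n.+2 != 0.
  have := mulf_neq0 B10 B30; rewrite e2 /xQ2.
  by apply: contraNneq => ->; rewrite expr0n.
move: yl ll yn ePn; set x := A n.+2 / B n.+2 => yl ll yn ePn.
have dx : x - x0 != 0.
  have xB : x * B n.+2 = A n.+2 by rewrite /x divfK.
  by apply: contraNneq d0 => /eqP; rewrite subr_eq0 -{1}xB => /eqP ->; rewrite subrr.
pose l3 := (y - y0) / (x - x0); pose x3 := l3 ^+ 2 - x0 - x.
have x3E : A n.+3 / B n.+3 = x3.
  (* The chord through -P and the current point has slope -l. *)
  have prev : A n.+1 / B n.+1 = ((y + y0) / (x - x0)) ^+ 2 - x - x0.
    have -> : (y + y0) / (x - x0) = - l by rewrite yl mulNr mulfK.
    by rewrite sqrrN ll /=; ring.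
  have sum : A n.+3 / B n.+3 + A n.+1 / B n.+1 =
    xQ1 a b x0 x 1 / xQ2 x0 x 1.
    have -> : xQ1 a b x0 x 1 = xQ1 a b x0 (A n.+2) (B n.+2) / B n.+2 ^+ 2.
      by rewrite /xQ1 /x; field.
    have -> : xQ2 x0 x 1 = xQ2 x0 (A n.+2) (B n.+2) / B n.+2 ^+ 2.
      by rewrite /xQ2 /x; field.
    by rewrite -e1 -e2; field; rewrite B20 B10 B30.
  have -> : A n.+3 / B n.+3 = xQ1 a b x0 x 1 / xQ2 x0 x 1 - A n.+1 / B n.+1.
    by rewrite -sum addrK.
  rewrite prev /x3 /l3 /xQ1 /xQ2.
  have -> : b = y0 ^+ 2 - x0 ^+ 3 - a * x0 by rewrite yx; ring.
  have ea : a * (x - x0) = y ^+ 2 - x ^+ 3 - (y0 ^+ 2 - x0 ^+ 3).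
    by rewrite yn yx; ring.
  have -> : a = (y ^+ 2 - x ^+ 3 - (y0 ^+ 2 - x0 ^+ 3)) / (x - x0).
    by rewrite -ea mulfK.
  by field; rewrite dx.
exists (l3 * (x0 - x3) - y0), l3; rewrite [_.-1]/= -/x x3E; split.
- have -> : ecval (ec_muln n.+3 P) =
      ec_add_raw a (Some (x0, y0)) (ecval (ec_muln n.+2 P)) by [].
  rewrite ePn /=; have -> : (x0 == x) = false by rewrite eq_sym -subr_eq0 (negPf dx).
  by [].
- by rewrite /l3; ring.
- by rewrite /x3; ring.
split; last by exists t.
(* The third Vieta relation makes the product of the outer denominators the square of this
   difference. *)
exists ((A n.+2 - x0 * B n.+2) / u); first by rewrite mulf_neq0 ?invr_eq0.
by rewrite expr_div_n -/(xQ2 _ _ _) -e2 [B n.+1]eu; field.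
Qed.

(** The denominators are nonzero squares, invisible to the character. *)
Lemma xcoord_muln (N n : nat) :
  (forall k, (0 < k <= N)%N -> B k != 0) -> (0 < n <= N)%N ->
  quad_char (xcoord (ec_muln n P)) = quad_char (A n).
Proof.
move=> B0; case: n => [|[|n]] // nN.
  (* The case n = 1 is separate: its predecessor is at infinity, so no state is available. *)
  by have [A1 _] := A1_B1; rewrite A1.
have : point_state n.+2.
  elim: n nN => [|n IHn] nN; first by apply: point_state2; apply: B0.
  by apply: point_stateS; [apply: B0|apply: IHn; apply: ltnW].
case=> y [l [e _ _ [[t t0 et] _]]]; rewrite /xcoord e et.
rewrite -[LHS]mulr1 -(quad_char_sqr t0) -quad_charM //.
by rewrite divfK // expf_neq0.
Qed.

End Specialization.

(** * Correlation sums over the curve *)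

Lemma sum_divn_expn (N K : nat) : (\sum_(1 <= k < K.+1) N %/ 2 ^ k <= N)%N.
Proof.
elim: K N => [|K IHK] N; first by rewrite big_geq.
rewrite big_nat_recl //= expn1.
have -> : (\sum_(1 <= i < K.+1) N %/ 2 ^ i.+1 = \sum_(1 <= i < K.+1) (N %/ 2) %/ 2 ^ i)%N.
  by apply: eq_bigr => i _; rewrite expnS divnMA.
by apply: leq_trans (leq_add (leqnn _) (IHK (N %/ 2)%N)) _; lia.
Qed.

(** The sum is the valuation of N!, given by Legendre's formula; p >= 2 compares it with a halving
    sum. *)
Lemma sum_logn_leq (p N : nat) : prime p -> (\sum_(1 <= n < N.+1) logn p n <= N)%N.
Proof.
move=> pr; have -> : (\sum_(1 <= n < N.+1) logn p n = logn p N`!)%N.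
  elim: N => [|N IHN]; first by rewrite big_geq // logn1.
  by rewrite big_nat_recr //= IHN factS lognM ?fact_gt0 // addnC.
rewrite logn_fact //; apply: leq_trans (sum_divn_expn N N).
apply: leq_sum => k _; apply: leq_div2l; first by rewrite expn_gt0.
by case: k => [|k]; rewrite ?expn0 // leq_exp2r // prime_gt1.
Qed.

Lemma sum_eq_nat_leq1 (N c : nat) : (\sum_(1 <= m < N.+1) (m == c) <= 1)%N.
Proof.
elim: N => [|N IHN]; first by rewrite big_geq.
rewrite big_nat_recr //=; case: eqP => [e|_]; last by rewrite addn0.
rewrite big_nat_cond big1 // => i /andP[/andP[_ iN] _].
by rewrite -e; case: eqP iN => // ->; rewrite ltnn.
Qed.

(** For given n the admissible m are among n / p^s with s at most the valuation of n. *)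
Lemma sum_pow_multiple (p N : nat) : prime p ->
  (\sum_(1 <= n < N.+1) \sum_(1 <= m < N.+1) pow_multiple p m n <= 2 * N)%N.
Proof.
move=> pr; have p1 := prime_gt1 pr.
apply: leq_trans (_ : \sum_(1 <= n < N.+1) (logn p n + 1) <= _)%N; last first.
  rewrite big_split /= sum_nat_const_nat muln1 mul2n -addnn subn1 /= leq_add2r.
  exact: sum_logn_leq.
rewrite big_nat_cond [X in (_ <= X)%N]big_nat_cond; apply: leq_sum => n /andP[/andP[n0 _] _].
apply: leq_trans (_ : \sum_(1 <= m < N.+1) \sum_(s < (logn p n).+1) (m == n %/ p ^ s) <= _)%N.
  apply: leq_sum => m _; case: (boolP (pow_multiple p m n)) => // /existsP[[s sn] /= /eqP e].
  have sl : (s < (logn p n).+1)%N.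
    by rewrite ltnS -pfactor_dvdn // e dvdn_mulr.
  have nm : (n %/ p ^ s = m)%N by rewrite e mulKn // expn_gt0 prime_gt0.
  by rewrite (bigD1 (Ordinal sl)) //= nm eqxx.
rewrite exchange_big /=; apply: leq_trans (_ : \sum_(s < (logn p n).+1) 1 <= _)%N.
  by apply: leq_sum => s _; apply: sum_eq_nat_leq1.
by rewrite sum1_card card_ord addn1.
Qed.

(** * Sums over the rational points *)

Section PointSums.

Variables (F : finFieldType) (a b : F).
Hypotheses (oF : odd #|F|).

(** The number of points above x is 1 plus the character of the cubic at x; c is the term at
    infinity. *)
Lemma sum_points_abscissa (c : int) (G : F -> int) :
  \sum_(P : ec a b) (if ecval P is Some (x, _) then G x else c) =
  c + \sum_x (1 + quad_char (weierstrass a b x)) * G x.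
Proof.
have -> : \sum_(P : ec a b) (if ecval P is Some (x, _) then G x else c) =
  \sum_(o | on_curve a b o) (if o is Some (x, _) then G x else c).
  rewrite [RHS](reindex_omap (@ecval F a b) insub) /=; last first.
    by move=> o oP; rewrite insubT.
  by apply: eq_bigl => P; rewrite ecvalP valK eqxx.
rewrite (bigD1 None) //=; congr (_ + _).
rewrite (reindex_omap Some id) /=; last by case.
rewrite (eq_bigl (fun xy : F * F => xy.2 ^+ 2 == weierstrass a b xy.1)); last first.
  by case=> x y /=; rewrite eqxx !andbT.
rewrite (eq_bigr (fun xy : F * F => G xy.1)); last by case.
rewrite -(pair_big_dep xpredT (fun x y => y ^+ 2 == weierstrass a b x) (fun x _ => G x)) /=.
apply: eq_bigr => x _; rewrite sumr_const -card_sqr_fiber // cardsE.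
by rewrite -mulr_natl natz.
Qed.

Lemma quad_char_factor (c : F) : 0 <= 1 + quad_char c <= 2.
Proof. by case: (quad_charP c) => ->. Qed.

Lemma card_points : #|{: ec a b}|%:Z = 1 + \sum_x (1 + quad_char (weierstrass a b x)).
Proof.
have := sum_points_abscissa 1 (fun=> 1); under [in RHS]eq_bigr do rewrite mulr1.
move=> <-; rewrite -sum1_card -natz natr_sum; apply: eq_bigr => P _.
by case: (ecval P) => [[x y]|].
Qed.

Lemma card_points_leq : (#|{: ec a b}| <= 3 * #|F|)%N.
Proof.
rewrite -lez_nat card_points.
apply: le_trans (_ : 1 + \sum_(x : F) 2 <= _).
  by rewrite lerD2l; apply: ler_sum => x _; have /andP[] := quad_char_factor (weierstrass a b x).
by rewrite sumr_const -mulr_natr; have := finNzRing_gt1 F; move: #|F| => q; lia.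
Qed.

Definition corr_sum (m n : nat) : int :=
  \sum_(P : ec a b) quad_char (xcoord (ec_muln m P) * xcoord (ec_muln n P)).

(** Multiplicativity separates P from Q, so the double sum over points factors into two equal
    sums. *)
Lemma U_sumE (N : nat) :
  U_sum a b N = \sum_(1 <= m < N.+1) \sum_(1 <= n < N.+1) corr_sum m n ^+ 2.
Proof.
rewrite /U_sum.
pose s (n : nat) (P : ec a b) := quad_char (xcoord (ec_muln n P)).
transitivity (\sum_(P : ec a b) \sum_(Q : ec a b) \sum_(1 <= m < N.+1)
    \sum_(1 <= n < N.+1) (s m P * s n P) * (s m Q * s n Q)).
  apply: eq_bigr => P _; apply: eq_bigr => Q _.
  rewrite real_normK ?num_real // expr2 /S_sum big_distrlr /=.
  apply: eq_bigr => m _; apply: eq_bigr => n _; rewrite !quad_charM // /s; ring.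
under eq_bigr do rewrite exchange_big /=; rewrite exchange_big /=.
apply: eq_bigr => m _.
under eq_bigr do rewrite exchange_big /=; rewrite exchange_big /=.
apply: eq_bigr => n _; rewrite expr2 /corr_sum big_distrlr /=.
by apply: eq_bigr => P _; apply: eq_bigr => Q _; rewrite !quad_charM.
Qed.

Lemma corr_sum_trivial (m n : nat) : `|corr_sum m n| <= (3 * #|F|)%:Z.
Proof.
apply: le_trans (ler_norm_sum _ _ _) _.
apply: le_trans (_ : \sum_(P : ec a b) 1 <= _).
  by apply: ler_sum => P _; apply: normr_quad_char_le1.
by rewrite sumr_const natz lez_nat card_points_leq.
Qed.

Hypotheses (two0 : 2%:R != 0 :> F) (ns : nonsingular a b).

(** Poles of one of the first N fractions; off this set [xcoord_muln] applies. *)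
Definition bad_abscissas (N : nat) : {set F} :=
  [set x | [exists k : 'I_N, root (xden a b k.+1) x]].

Lemma card_bad_abscissas (N : nat) : (#|bad_abscissas N| <= N ^ 3)%N.
Proof.
apply: leq_trans (_ : \sum_(k < N) #|[set x | root (xden a b k.+1) x]| <= _)%N.
  under eq_bigr do rewrite -sum1_card big_mkcond /=.
  rewrite exchange_big /= -sum1_card big_mkcond /=; apply: leq_sum => x _.
  rewrite inE; case: existsP => // -[k kx].
  by rewrite (bigD1 k) //= inE kx.
apply: leq_trans (_ : \sum_(k < N) N ^ 2 <= _)%N; last first.
  by rewrite sum_nat_const card_ord -expnS.
apply: leq_sum => k _; apply/ltnW/(leq_trans (card_roots_lt _)).
  exact: xden_neq0.
apply: leq_trans (size_xden_leq two0 ns _) _.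
by rewrite leq_exp2r.
Qed.

Lemma corr_sum_approx (N m n : nat) : (0 < m <= N)%N -> (0 < n <= N)%N ->
  `|corr_sum m n - (\sum_x quad_char (xnum a b m * xnum a b n).[x]
     + \sum_x quad_char (weierstrass a%:P b%:P 'X * (xnum a b m * xnum a b n)).[x])|
  <= (4 * N ^ 3 + 1)%:Z.
Proof.
move=> mN nN.
pose G (x : F) : int := quad_char (xnum a b m * xnum a b n).[x].
have -> : \sum_x quad_char (xnum a b m * xnum a b n).[x] +
    \sum_x quad_char (weierstrass a%:P b%:P 'X * (xnum a b m * xnum a b n)).[x] =
    \sum_(P : ec a b) (if ecval P is Some (x, _) then G x else 0).
  rewrite (sum_points_abscissa 0) add0r -big_split /=; apply: eq_bigr => x _.
  rewrite [RHS]mulrDl mul1r; congr (_ + _).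
  rewrite hornerM quad_charM //; congr (quad_char _ * _).
  have := rmorph_weierstrass (horner_eval x) a%:P b%:P 'X.
  by rewrite /= !horner_evalE !hornerC hornerX.
rewrite /corr_sum -sumrB; apply: le_trans (ler_norm_sum _ _ _) _.
(* The error is at most 1 at infinity and 2 at each of the at most two points above a bad
   abscissa. *)
apply: le_trans (_ : \sum_(P : ec a b)
   (if ecval P is Some (x, _) then 2 * (x \in bad_abscissas N)%:Z else 1) <= _).
  apply: ler_sum => P _.
  have le1 := normr_quad_char_le1 (xcoord (ec_muln m P) * xcoord (ec_muln n P)).
  case: P le1 => [[[x y]|] cP] le1; last by rewrite subr0.
  rewrite [ecval _]/=; case: (boolP (x \in bad_abscissas N)) => [xbad|xgood].
    apply: le_trans (ler_normB _ _) _; rewrite xbad.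
    exact: lerD le1 (normr_quad_char_le1 _).
  have good k : (0 < k <= N)%N -> (xden a b k).[x] != 0.
    case: k => // k kN; apply: contra xgood => kx; rewrite inE.
    by apply/existsP; exists (Ordinal kN).
  rewrite /G hornerM !quad_charM // (xcoord_muln oF two0 ns cP good mN).
  by rewrite (xcoord_muln oF two0 ns cP good nN) subrr normr0 (negPf xgood).
rewrite sum_points_abscissa addrC.
rewrite PoszD; apply: lerD => //.
apply: le_trans (_ : \sum_(x in bad_abscissas N) 4 <= _); last first.
  by rewrite sumr_const -mulr_natr; have := card_bad_abscissas N; move: #|_| => k; lia.
rewrite [leRHS]big_mkcond /=; apply: ler_sum => x _.
have /andP[_ c2] := quad_char_factor (weierstrass a b x).
by case: ifP => _; rewrite ?mulr0 // mulr1; lia.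
Qed.

End PointSums.

Lemma exists_sqrtn (q : nat) : exists l, (l ^ 2 <= q)%N /\ (q < l.+1 ^ 2)%N.
Proof.
elim: q => [|q [l [lq ql]]]; first by exists 0%N.
have [h|h] := ltnP q.+1 (l.+1 ^ 2); first by exists l; split=> //; apply: leq_trans lq _.
by exists l.+1; split=> //; apply: leq_ltn_trans ql _; rewrite ltn_exp2r.
Qed.

Lemma sqr_le_of_norm_le (x : int) (k : nat) : `|x| <= k%:Z -> x ^+ 2 <= (k ^ 2)%N%:Z.
Proof.
move=> xk; rewrite -real_normK ?num_real // -natz natrX natz.
by rewrite lerXn2r ?nnegrE.
Qed.

(** * Bounds for the moment U(N) *)

Section CurveBounds.

Variables (F : finFieldType) (a b : F).
Hypotheses (oF : odd #|F|) (ns : nonsingular a b) (b0 : b != 0).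

(** Both polynomials have degree at most 5N^2, hence the condition 40 N^2 <= l. The constant is 145
    = 4 + 1 + 40 + 100: the approximation error, then the two character sums. *)
Lemma corr_sum_bound (p l N m n : nat) : p \in [pchar F] ->
  (l ^ 2 <= #|F|)%N -> (#|F| < l.+1 ^ 2)%N -> (40 * N ^ 2 <= l)%N ->
  (0 < m <= N)%N -> (0 < n <= N)%N ->
  ~~ (pow_multiple p m n || pow_multiple p n m) ->
  `|corr_sum a b m n| <= (145 * N ^ 2 * l)%N%:Z.
Proof.
move=> pF lq ql Nl mN nN nmul; have two0 := natr2_neq0 oF.
have /andP[m0 mleN] := mN; have /andP[n0 nleN] := nN.
have m2 : (m ^ 2 <= N ^ 2)%N by rewrite leq_exp2r.
have n2 : (n ^ 2 <= N ^ 2)%N by rewrite leq_exp2r.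
have N2 : (0 < N ^ 2)%N by rewrite expn_gt0 (leq_trans m0 mleN).
set f1 := xnum a b m * xnum a b n.
set f2 := weierstrass a%:P b%:P 'X * f1.
have nz k : xnum a b k != 0 by rewrite -size_poly_gt0 (size_xnum two0 ns).
have sz1 : size f1 = (m ^ 2 + n ^ 2).+1.
  by rewrite size_mul // !(size_xnum two0 ns) addnS.
have [g0 sg] := weierstrass_poly_neq0_size a b.
have sz2 : size f2 = (m ^ 2 + n ^ 2 + 3).+1.
  by rewrite size_mul ?mulf_neq0 // sg sz1; lia.
have nsq1 : ~ const_sqr f1.
  move=> /(xnumM_const_sqr oF ns b0 pF m0 n0)[i [j e]].
  by move: nmul; rewrite (eq_sqr_mul_pow (pcharf_prime pF) m0 n0 e).
have nsq2 : ~ const_sqr f2 by apply: weierstrassM_nconst_sqr.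
have b1 := quad_char_sum_bound oF nsq1 lq ql.
have b2 := quad_char_sum_bound oF nsq2 lq ql.
rewrite sz1 /= in b1; rewrite sz2 /= in b2.
have {}b1 : `|\sum_x quad_char f1.[x]| <= (20 * (m ^ 2 + n ^ 2) * l)%N%:Z.
  by apply: b1; lia.
have {}b2 : `|\sum_x quad_char f2.[x]| <= (20 * (m ^ 2 + n ^ 2 + 3) * l)%N%:Z.
  by apply: b2; lia.
have ap := corr_sum_approx oF two0 ns mN nN; rewrite -/f1 -/f2 in ap.
have N3 : (N ^ 3 <= N ^ 2 * l)%N.
  rewrite expnS mulnC leq_mul2l; apply/orP; right.
  have NN : (N <= N ^ 2)%N by rewrite -mulnn leq_pmulr // (leq_trans m0).
  by apply: leq_trans NN (leq_trans _ Nl); rewrite leq_pmull.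
have tri : `|corr_sum a b m n| <= (4 * N ^ 3 + 1)%N%:Z +
    ((20 * (m ^ 2 + n ^ 2) * l)%N%:Z + (20 * (m ^ 2 + n ^ 2 + 3) * l)%N%:Z).
  rewrite -[corr_sum a b m n](subrK (\sum_x quad_char f1.[x] + \sum_x quad_char f2.[x])).
  apply: le_trans (ler_normD _ _) (lerD ap _).
  exact: le_trans (ler_normD _ _) (lerD b1 b2).
apply: le_trans tri _; rewrite -!PoszD lez_nat.
have ml : (m ^ 2 * l <= N ^ 2 * l)%N by rewrite leq_mul2r m2 orbT.
have nl : (n ^ 2 * l <= N ^ 2 * l)%N by rewrite leq_mul2r n2 orbT.
have l1 : (l <= N ^ 2 * l)%N by rewrite leq_pmull.
have l0 : (1 <= l)%N by lia.
move: N3 ml nl l1 l0; rewrite -!mulnA.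
move: (N ^ 2 * l)%N (N ^ 3)%N => X Y; lia.
Qed.

(** The exceptional pairs, at most 4N counting both orders, take the trivial bound 9 q^2; the others
    use l^2 <= q. *)
Lemma U_sum_small (l N : nat) : (0 < N)%N ->
  (l ^ 2 <= #|F|)%N -> (#|F| < l.+1 ^ 2)%N -> (40 * N ^ 2 <= l)%N ->
  U_sum a b N <= (36 * N * #|F| ^ 2 + 145 ^ 2 * N ^ 6 * #|F|)%N%:Z.
Proof.
move=> N0 lq ql Nl; have [p pr pF] := finPcharP F.
pose c m n := (pow_multiple p m n + pow_multiple p n m)%N.
rewrite U_sumE //.
apply: le_trans (_ : \sum_(1 <= m < N.+1) \sum_(1 <= n < N.+1)
  ((9 * #|F| ^ 2 * c m n + 145 ^ 2 * N ^ 4 * #|F|)%N%:Z) <= _).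
  rewrite big_nat_cond [leRHS]big_nat_cond; apply: ler_sum => m /andP[mN _].
  rewrite big_nat_cond [leRHS]big_nat_cond; apply: ler_sum => n /andP[nN _].
  rewrite !ltnS in mN nN.
  have [mul|nmul] := boolP (pow_multiple p m n || pow_multiple p n m).
    apply: le_trans (sqr_le_of_norm_le (corr_sum_trivial a b oF m n)) _.
    rewrite lez_nat; have c1 : (1 <= c m n)%N.
      by move: mul; rewrite /c; do 2 case: pow_multiple.
    rewrite expnMn; apply: leq_trans (leq_addr _ _); rewrite leq_pmulr //.
  have bd := corr_sum_bound pF lq ql Nl mN nN nmul.
  apply: le_trans (sqr_le_of_norm_le bd) _; rewrite lez_nat.
  apply: leq_trans (leq_addl _ _); rewrite expnMn (expnMn 145) -expnM.
  by rewrite leq_mul.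
have PoszS := big_morph Posz PoszD (erefl 0%:Z).
under eq_bigr do rewrite -PoszS; rewrite -PoszS lez_nat.
under eq_bigr do rewrite big_split /= -big_distrr /= sum_nat_const_nat subSS subn0.
rewrite big_split /= -big_distrr /= sum_nat_const_nat subSS subn0; apply: leq_add.
  have cle : (\sum_(1 <= m < N.+1) \sum_(1 <= n < N.+1) c m n <= 4 * N)%N.
    under eq_bigr do rewrite big_split; rewrite big_split /= exchange_big /=.
    have := sum_pow_multiple N pr; move: (\sum_(1 <= n < N.+1) _)%N => X.
    by lia.
  apply: leq_trans (leq_mul (leqnn _) cle) _; rewrite mulnACA; lia.
by rewrite (_ : 6 = 1 + (1 + 4))%N // !expnD !expn1; lia.
Qed.

Lemma U_sum_trivial (N : nat) : U_sum a b N <= (9 * N ^ 2 * #|F| ^ 2)%N%:Z.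
Proof.
rewrite U_sumE //.
apply: le_trans (_ : \sum_(1 <= m < N.+1) \sum_(1 <= n < N.+1)
  (((3 * #|F|) ^ 2)%N%:Z) <= _).
  apply: ler_sum => m _; apply: ler_sum => n _.
  exact: sqr_le_of_norm_le (corr_sum_trivial a b oF m n).
have PoszS := big_morph Posz PoszD (erefl 0%:Z).
under eq_bigr do rewrite -PoszS; rewrite -PoszS lez_nat.
by rewrite !sum_nat_const_nat subSS subn0 expnMn -!mulnn; lia.
Qed.

Lemma U_sum_bound (N : nat) : (0 < N)%N ->
  U_sum a b N <= (145 ^ 2 * (N ^ 6 * #|F| + N * #|F| ^ 2))%N%:Z.
Proof.
move=> N0; have [l [lq ql]] := exists_sqrtn #|F|.
have [Nl|lN] := leqP (40 * N ^ 2) l.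
  apply: le_trans (U_sum_small N0 lq ql Nl) _; rewrite lez_nat mulnDr addnC mulnA.
  by apply: leq_add => //; rewrite mulnA leq_mul2r leq_mul2r; lia.
apply: le_trans (U_sum_trivial N) _; rewrite lez_nat.
(* When l < 40 N^2, one factor q of the trivial bound is absorbed by N^4, and 9 * 1600 is below
   145^2. *)
have qN : (#|F| <= 1600 * N ^ 4)%N.
  apply: ltnW; apply: leq_trans ql _.
  by rewrite (_ : 1600 * N ^ 4 = (40 * N ^ 2) ^ 2)%N ?leq_exp2r // expnMn -expnM.
apply: leq_trans (_ : 9 * N ^ 2 * (#|F| * (1600 * N ^ 4)) <= _)%N.
  by rewrite leq_mul2l -mulnn leq_mul2l qN !orbT.
rewrite (_ : 6 = 2 + 4)%N // expnD; move: (N ^ 2)%N (N ^ 4)%N => X Y; lia.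
Qed.

End CurveBounds.

Theorem theorem6 (R : realType) :
  exists2 c : R, 0 < c &
    forall (F : finFieldType) (a b : F),
      coprime #|F| 6 -> nonsingular a b -> ordinary a b -> b != 0 ->
      forall N : nat, (0 < N)%N ->
        `|(U_sum a b N)%:~R : R|
          <= c * (N%:R ^+ 6 * #|F|%:R + N%:R * #|F|%:R ^+ 2).
Proof.
exists (145 ^ 2)%N%:R; first by rewrite ltr0n expn_gt0.
move=> F a b cop ns _ b0 N N0.
have oF : odd #|F|.
  by rewrite -coprimen2; apply: coprime_dvdr cop.
have U0 : 0 <= U_sum a b N.
  by apply: sumr_ge0 => P _; apply: sumr_ge0 => Q _; rewrite exprn_ge0.
rewrite ger0_norm ?ler0z //.
rewrite -!natrX -!natrM -natrD -natrM [leRHS]pmulrn ler_int.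
exact: U_sum_bound.
Qed.
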